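(* Let $\mathcal{G}$ be the generic structure for the class of all finite flat pregeometries with respect to $\sqsubseteq$, viewed as an $\mathcal{L}$-structure. Then $\mathcal{G}$ is saturated.
   Context: Pregeometries. A pregeometry $G$ on a (possibly infinite) set $M$ is a function $d=d_G$ from the finite subsets of $M$ to $\mathbb{N}$ such that $d(\emptyset)=0$, $d(A)\le d(A\cup\{x\})\le d(A)+1$, and $d(A\cup B)+d(A\cap B)\le d(A)+d(B)$. A finite $A$ is independent if $d(A)=|A|$; an arbitrary set is independent if all its finite subsets are; $d(Y)=\sup\{|Y_0|: Y_0\subseteq Y \text{ independent}\}$. For finite $A$, $\mathrm{cl}_G(A)=\{x: d(A\cup\{x\})=d(A)\}$, and $\mathrm{cl}_G(Y)=\bigcup\{\mathrm{cl}_G(Y_0): Y_0\subseteq Y\text{ finite}\}$. $Y$ is closed in $G$ if $\mathrm{cl}_G(Y)=Y$. A subpregeometry $H\subseteq G$ is the restriction of $d_G$ to subsets of a subset. For a finite collection $\Sigma=\{E_1,\dots,E_k\}$ of finite-dimensional closed sets of $G$ let $\Delta_G(\Sigma)=\sum_{\emptyset\ne s\subseteq\{1,\dots,k\}}(-1)^{|s|+1}d_G\left(\bigcap_{i\in s}E_i\right)$. $G$ is flat if $\Delta_G(\Sigma)\ge d_G(\bigcup\Sigma)$ for every such $\Sigma$. For $H\subseteq G$, $H\sqsubseteq G$ means that for every finite collection $\Sigma$ of finite-dimensional closed sets of $G$, $\Delta_H(\{E\cap H: E\in\Sigma\})\le\Delta_G(\Sigma)$. Language. Pregeometries are structures in the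 language $\mathcal{L}=\{I_n:n\in\omega\}$, $I_n$ an $n$-ary relation symbol interpreted as the set of independent $n$-tuples. Generic structure. Let $\mathfrak{C}$ be the class of all finite flat pregeometries. $\mathcal{G}$ is the countable pregeometry, unique up to isomorphism, such that: (i) up to isomorphism, the finite $A\sqsubseteq\mathcal{G}$ are exactly the members of $\mathfrak{C}$; (ii) whenever $A\sqsubseteq\mathcal{G}$ is finite and $A\sqsubseteq B\in\mathfrak{C}$, there is an embedding $f:B\to\mathcal{G}$ fixing $A$ pointwise with $f[B]\sqsubseteq\mathcal{G}$; (iii) every finite subset of $\mathcal{G}$ is contained in a finite $A\sqsubseteq\mathcal{G}$. *)

(* Defs.v *)
From mathcomp Require Import all_boot all_order all_algebra.
From mathcomp Require Import finmap.
From mathcomp Require Import boolp classical_sets functions cardinality.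
Set Implicit Arguments.
Unset Strict Implicit.
Unset Printing Implicit Defensive.
Import Order.TTheory GRing.Theory Num.Theory.
Local Open Scope fset_scope.
Local Open Scope classical_set_scope.

Record pregeometry (M : choiceType) := Pregeometry {
  dim :> {fset M} -> nat;
  dim0 : dim fset0 = 0;
  dim_step : forall A x, dim A <= dim (x |` A)%fset <= (dim A).+1;
  dim_submod : forall A B, dim (A `|` B)%fset + dim (A `&` B)%fset <= dim A + dim B }.

Section Pregeometry.
Variables (M : choiceType) (G : pregeometry M).
Implicit Types (Y : set M) (A : {fset M}).

Definition indep A := G A = #|` A|.

(* An infinite independent subset of Y has independent finite subsets of every
   size, so restricting to finite subsets does not change the supremum. *)
Definition indep_sizes Y : set nat :=
  [set #|` A| | A in [set A : {fset M} | [set` A] `<=` Y /\ indep A]].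

Definition finite_dim Y := exists n, ubound (indep_sizes Y) n.

(* Meaningful only for finite_dim Y; otherwise the value is 0. *)
Definition sdim Y : nat := supremum 0 (indep_sizes Y).

Definition fcl A : set M := [set x | G (x |` A)%fset = G A].

Definition cl Y : set M :=
  \bigcup_(A in [set A : {fset M} | [set` A] `<=` Y]) fcl A.

Definition is_closed Y := cl Y = Y.

(* Collections are indexed by 'I_k; repetitions do not change the alternating
   sum. *)
Definition Delta k (E : 'I_k -> set M) : int :=
  (\sum_(s : {set 'I_k} | s != finset.set0)
     (-1) ^+ #|s|.+1 * (sdim (\bigcap_(i in [set` s]) E i))%:Z)%R.

Definition fd_closed k (E : 'I_k -> set M) :=
  forall i, is_closed (E i) /\ finite_dim (E i).

Definition flat := forall k (E : 'I_k -> set M), fd_closed E ->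
  ((sdim (\bigcup_i E i))%:Z <= Delta E)%R.

End Pregeometry.

Section Subpregeometry.
Variables (M : choiceType) (G : pregeometry M) (H : set M).

Let subdim (A : {fset H}) : nat := G [fset set_val x | x in A].

Fact subdim0 : subdim fset0 = 0.
Proof. by rewrite /subdim imfset0 dim0. Qed.

Fact subdim_step A x : subdim A <= subdim (x |` A)%fset <= (subdim A).+1.
Proof. by rewrite /subdim imfsetU1; apply: dim_step. Qed.

Fact subdim_submod A B :
  subdim (A `|` B)%fset + subdim (A `&` B)%fset <= subdim A + subdim B.
Proof.
rewrite /subdim imfsetU imfsetI; first exact: dim_submod.
by move=> x y _ _; apply: val_inj.
Qed.

Definition subpregeometry : pregeometry H :=
  Pregeometry subdim0 subdim_step subdim_submod.

End Subpregeometry.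

Definition strong (M : choiceType) (G : pregeometry M) (H : set M) :=
  forall k (E : 'I_k -> set M), fd_closed G E ->
    (Delta (subpregeometry G H) (fun i => set_val @^-1` E i) <= Delta G E)%R.

Definition embedding (M N : choiceType) (G : pregeometry M)
    (K : pregeometry N) (f : M -> N) :=
  injective f /\ forall A : {fset M}, K [fset f x | x in A] = G A.

Definition isomorphic (M N : choiceType) (G : pregeometry M)
    (K : pregeometry N) :=
  exists2 f : M -> N, bijective f & embedding G K f.

(* In the extension property, an inclusion of A in B is an embedding g of the
   subpregeometry on A into B, and f fixes A pointwise modulo g. *)
Record is_generic (M : countType) (G : pregeometry M) : Prop := IsGeneric {
  generic_age : forall A : set M, finite_set A -> strong G A ->
    exists (T : finType) (B : pregeometry T),
      flat B /\ isomorphic B (subpregeometry G A);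
  generic_universal : forall (T : finType) (B : pregeometry T), flat B ->
    exists A : set M, [/\ finite_set A, strong G A
      & isomorphic B (subpregeometry G A)];
  generic_extension : forall A : set M, finite_set A -> strong G A ->
    forall (T : finType) (B : pregeometry T) (g : A -> T), flat B ->
    embedding (subpregeometry G A) B g -> strong B (range g) ->
    exists f : T -> M, [/\ embedding B G f,
      forall a : A, f (g a) = set_val a & strong G (range f)];
  generic_cover : forall X : set M, finite_set X ->
    exists A : set M, [/\ X `<=` A, finite_set A & strong G A] }.

Record language := Language { symbol : Type; arity : symbol -> nat }.

Record structure (L : language) := Structure {
  carrier :> Type;
  interp : forall s : symbol L, (arity s).-tuple carrier -> Prop }.

Inductive term (C : Type) (n : nat) := Var of 'I_n | Cst of C.

(* Formulas with constants from C and free variables among the 'I_n; a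
   quantifier binds variable 0 and shifts the others. *)
Inductive formula (L : language) (C : Type) : nat -> Type :=
| Rel n (s : symbol L) of (arity s).-tuple (term C n) : formula L C n
| Eq n of term C n & term C n : formula L C n
| Bot n : formula L C n
| Imp n of formula L C n & formula L C n : formula L C n
| All n of formula L C n.+1 : formula L C n.

Definition Neg L C n (phi : formula L C n) := Imp phi (Bot L C n).

Section Semantics.
Variables (L : language) (M : structure L).

Definition eval C (c : C -> M) n (e : n.-tuple M) (t : term C n) : M :=
  match t with Var i => tnth e i | Cst a => c a end.

Fixpoint sat C (c : C -> M) n (phi : formula L C n) : n.-tuple M -> Prop :=
  match phi in formula _ _ n return n.-tuple M -> Prop with
  | Rel n s t => fun e => interp [tuple of map (eval c e) t]
  | Eq n t u => fun e => eval c e t = eval c e u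
  | Bot n => fun e => False
  | Imp n phi psi => fun e => sat c phi e -> sat c psi e
  | All n phi => fun e => forall x, sat c phi [tuple of x :: e]
  end.

Definition realizes (A : set M) n (e : n.-tuple M) (p : set (formula L A n)) :=
  forall phi, p phi -> sat set_val phi e.

Definition complete_type (A : set M) n (p : set (formula L A n)) :=
  (forall q, finite_set q -> q `<=` p -> exists e, realizes e q) /\
  (forall phi, p phi \/ p (Neg phi)).

Definition saturated := forall A : set M, ~ ([set: M] #<= A)%card ->
  forall n (p : set (formula L A n)), complete_type p ->
  exists e, realizes e p.

End Semantics.

Definition pregeometry_language := @Language nat id.

Definition pregeometry_structure (M : choiceType) (G : pregeometry M) :=
  @Structure pregeometry_language M
    (fun n (t : n.-tuple M) => G [fset x in tval t] = n).

(* Main.v *)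
Require Import Defs.
From mathcomp Require Import all_boot all_order all_algebra finmap.
From mathcomp Require Import boolp classical_sets functions cardinality filter.
From mathcomp Require Import zify ring.

(** A set A of parameters smaller than the countable structure is finite, so let p
    be a type over a finite A. Take an ultrafilter U on the finite parts of p, and
    for each finite part a tuple realizing it. These tuples form a tuple of the
    ultrapower K of G along U. It suffices to find a tuple in G satisfying the
    same formulas over A, and this is done by a back and forth between finite
    strong subsets of G and of K with the same dimension function
    ([sat_transfer]).

    Three facts make the back and forth work. First, every finite subset of a flat
    pregeometry lies in a finite strong subset ([finite_strong_closure]). This is
    needed in K, where the sizes of strong closures in the coordinates may be
    unbounded. The dependencies of rank at most r are measured by the cheapest
    covers by closed sets of dimension at most r; one adds, for decreasing r, the
    finitely many points that span an optimal cover, and each set stays inside the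
    covers chosen before.

    Second, if T is strong in a finite flat T', then T' can be amalgamated freely
    with any finite flat A containing T, even when T is not strong in A
    ([free_amalgam]). The reason is that T' is obtained from T by adding points and
    relations, in the sense of a relative predimension
    ([exists_relative_predimension]), and the same points and relations can be
    added to A. Every failure of strength of T' in the amalgam comes from a
    failure of strength of T in A, with as many closed sets and no larger
    dimensions ([generic_extension_transfer]).

    Third, dimensions of internal finite-dimensional sets, and hence alternating
    sums, are computed in almost all coordinates of K ([internal_alt]). So K is
    flat, and a copy of T strong in K has coordinates for which any fixed bound on
    the number and the dimension of the closed sets excludes failures of strength
    almost everywhere. By the second fact the coordinates can be extended
    separately, and the result is again strong in K
    ([strong_of_coord_transfer]). *)

Set Implicit Arguments.
Unset Strict Implicit.
Unset Printing Implicit Defensive.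
Import Order.TTheory GRing.Theory Num.Theory.
Local Open Scope fset_scope.
Local Open Scope classical_set_scope.

(** * Inclusion-exclusion over lists of sets *)

Section InclusionExclusion.
Variable X : Type.
Implicit Types (f g : set X -> int) (A E F Y : set X) (s t : seq (set X)).
Local Open Scope ring_scope.

(** The alternating sum of f over the intersections of nonempty subfamilies of s,
    by recursion on s (see [ie_powerset]). This form makes the effect of adding
    one set a definitional equality, which drives all inductions below. *)
Fixpoint ie f s : int :=
  if s is E :: s' then f E + ie f s' - ie (fun F => f (E `&` F)) s' else 0.

(** Only the values of f on intersections of members of s matter; K is any
    intersection-closed class that contains them. *)
Lemma ie_ext (K : set X -> Prop) f g s :
  (forall E F, K E -> K F -> K (E `&` F)) -> (forall E, K E -> f E = g E) ->
  (forall E, E \in s -> K E) -> ie f s = ie g s.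
Proof.
move=> KI; elim: s f g => //= E s IH f g fg Ks.
have KE : K E by apply: Ks; rewrite inE eqxx.
have Ks' F : F \in s -> K F by move=> Fs; apply: Ks; rewrite inE Fs orbT.
rewrite fg// (IH f g)//; congr (_ - _); apply: IH => // F KF.
by apply: fg; apply: KI.
Qed.

Lemma eq_ie f g s : f =1 g -> ie f s = ie g s.
Proof. by move=> fg; apply: (@ie_ext (fun=> True)). Qed.

Lemma ieD f g s : ie (fun E => f E + g E) s = ie f s + ie g s.
Proof. by elim: s f g => [|E s IH] f g /=; rewrite ?addr0// !IH; ring. Qed.

Lemma ieZ (c : int) f s : ie (fun E => c * f E) s = c * ie f s.
Proof. by elim: s f => [|E s IH] f /=; rewrite ?mulr0// !IH; ring. Qed.

Lemma ieB f g s : ie (fun E => f E - g E) s = ie f s - ie g s.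
Proof. by elim: s f g => [|E s IH] f g /=; rewrite ?subr0// !IH; ring. Qed.

Lemma ie_sum (I : finType) (F : I -> set X -> int) s :
  ie (fun E => \sum_i F i E) s = \sum_i ie (F i) s.
Proof.
elim: s F => [|E s IH] F /=; first by rewrite big1.
by rewrite !IH -big_split -sumrB.
Qed.

(** The counting form of inclusion-exclusion; by linearity it evaluates [ie] on
    every weighted count of subsets, as in [ie_mass] and [ie_outside]. *)
Lemma ie_subset A s :
  ie (fun Y => `[< A `<=` Y >]%:Z) s = `[< exists2 E, E \in s & A `<=` E >]%:Z.
Proof.
elim: s => [|E s IH] /=.
  by case: asboolP => // -[].
have -> : ie (fun F => (`[< A `<=` E `&` F >] : nat)%:Z) s =
    `[< A `<=` E >]%:Z * ie (fun Y => `[< A `<=` Y >]%:Z) s.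
  rewrite -ieZ; apply: eq_ie => F; rewrite subsetI.
  by rewrite asbool_and; case: asboolP; case: asboolP.
rewrite {}IH.
have -> : `[< exists2 F, F \in E :: s & A `<=` F >] =
    `[< A `<=` E >] || `[< exists2 F, F \in s & A `<=` F >].
  apply/asboolP/orP => [[F]|[/asboolP AE|/asboolP[F Fs AF]]].
  - rewrite inE => /orP[/eqP -> ?|Fs AF]; first by left; apply/asboolP.
    by right; apply/asboolP; exists F.
  - by exists E; rewrite ?inE ?eqxx.
  - by exists F; rewrite // inE Fs orbT.
by case: asboolP; case: asboolP.
Qed.

Lemma ie_setI f E s : ie f [seq E `&` F | F <- s] = ie (fun F => f (E `&` F)) s.
Proof.
elim: s f => //= F s IH f; rewrite !IH; congr (_ - _).
by apply: eq_ie => Y; rewrite setIACA setIid.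
Qed.

Lemma ie_swap f E F s : ie f (E :: F :: s) = ie f (F :: E :: s).
Proof.
rewrite /= (setIC F E).
have -> : ie (fun Y => f (E `&` (F `&` Y))) s = ie (fun Y => f (F `&` (E `&` Y))) s.
  by apply: eq_ie => Y; rewrite setICA.
ring.
Qed.

Lemma ie_cons_ext f E s t : (forall g, ie g s = ie g t) ->
  ie f (E :: s) = ie f (E :: t).
Proof. by move=> st /=; rewrite !st. Qed.

Lemma ie_catC f s t : ie f (s ++ t) = ie f (t ++ s).
Proof.
have mid E s1 s2 g : ie g (s1 ++ E :: s2) = ie g (E :: s1 ++ s2).
  elim: s1 g => // F s1 IH g.
  by rewrite cat_cons (ie_cons_ext _ _ IH) ie_swap.
elim: s f => [|E s IH] f; first by rewrite cats0.
by rewrite mid cat_cons; apply: ie_cons_ext.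
Qed.

(** So adding to s a set contained in a member of s does not change [ie f s]. *)
Lemma ie_absorb f E s : (exists2 F, F \in s & E `<=` F) ->
  ie (fun F => f (E `&` F)) s = f E.
Proof.
case=> F + EF; elim: s f E EF => //= F' s IH f E EF; rewrite inE => /orP[|Fs].
  move/eqP => <-; rewrite setIidl//.
  have -> : ie (fun Y => f (E `&` (F `&` Y))) s = ie (fun Y => f (E `&` Y)) s.
    by apply: eq_ie => Y; rewrite setIA (setIidl EF).
  by rewrite addrK.
rewrite IH//.
have -> : ie (fun Y => f (E `&` (F' `&` Y))) s = ie (fun Y => f ((E `&` F') `&` Y)) s.
  by apply: eq_ie => Y; rewrite setIA.
rewrite IH//; first by ring.
by apply: subset_trans EF; apply: subIsetl.
Qed.

Lemma ie_cat f s t : ie f (s ++ t) =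
  ie f s + ie f t - ie (fun E => ie (fun F => f (E `&` F)) t) s.
Proof.
elim: s f => [|E s IH] f /=; first by ring.
have -> : ie (fun F => ie (fun F0 => f (E `&` F `&` F0)) t) s =
          ie (fun F => ie (fun F0 => f (E `&` (F `&` F0))) t) s.
  by apply: eq_ie => F; apply: eq_ie => Y; rewrite setIA.
rewrite !IH; ring.
Qed.

Definition isects s t := [seq E `&` F | E <- s, F <- t].

Lemma isectsP s t E : E \in isects s t ->
  exists E1 E2, [/\ E1 \in s, E2 \in t & E = E1 `&` E2].
Proof. by move=> /allpairsP[[E1 E2]] [? ? ->]; exists E1, E2. Qed.

Lemma ie_isects f s t :
  ie f (isects s t) = ie (fun E => ie (fun F => f (E `&` F)) t) s.
Proof.
have crossC g u v : ie (fun E => ie (fun F => g (E `&` F)) v) u =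
                    ie (fun E => ie (fun F => g (E `&` F)) u) v.
  by have := ie_catC g u v; rewrite !ie_cat; lia.
elim: s f => [|E s IH] f //=.
rewrite /isects /= -/(isects s t) ie_cat ie_setI.
have KP : ie (fun Y => ie (fun F => f (Y `&` F)) [seq E `&` F | F <- t]) (isects s t)
   = ie (fun Y => f (E `&` Y)) (isects s t).
  apply: (@ie_ext (fun Y => exists2 F, F \in t & Y `<=` F)).
  - by move=> Y1 Y2 [F Ft YF] _; exists F => //; apply: subset_trans YF; apply: subIsetl.
  - move=> Y YF; rewrite ie_setI.
    rewrite -[RHS](ie_absorb (fun Y => f (E `&` Y)) YF).
    by apply: eq_ie => F; rewrite setICA.
  - by move=> Y /isectsP[E1 [E2 [_ E2t ->]]]; exists E2 => //; apply: subIsetr.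
rewrite crossC KP !IH; congr (_ - _).
by apply: eq_ie => Y; apply: eq_ie => F; rewrite setIA.
Qed.

(** Inclusion-exclusion is a valuation on the lattice of finite unions of
    members: s ++ t is the union and [isects s t] the intersection. *)
Lemma ie_modular f s t : ie f (s ++ t) + ie f (isects s t) = ie f s + ie f t.
Proof. by rewrite ie_cat ie_isects subrK. Qed.

End InclusionExclusion.

Section InclusionExclusionMap.
Local Open Scope ring_scope.

Lemma ie_map (X Y : Type) (h : set X -> set Y) (f : set Y -> int) s :
  (forall E F, h (E `&` F) = h E `&` h F) ->
  ie f (map h s) = ie (f \o h) s.
Proof.
move=> hI; elim: s f => //= E s IH f; rewrite !IH; congr (_ - _).
by apply: eq_ie => F /=; rewrite hI.
Qed.

(** Splitting the nonempty index sets by membership of one index a: those that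
    contain a are {a} and the a |: s, which give the first and last term of the
    recursion. *)
Lemma ie_powerset (X : Type) (I : finType) (E : I -> set X) (f : set X -> int) :
  \sum_(s : {set I} | s != finset.set0)
     (-1) ^+ #|s|.+1 * f (\bigcap_(i in [set` s]) E i) =
  ie f [seq E i | i <- enum I].
Proof.
suff H (l : seq I) g : uniq l ->
    \sum_(s : {set I} | (s != finset.set0) && (s \subset [set i in l]%SET))
      (-1) ^+ #|s|.+1 * g (\bigcap_(i in [set` s]) E i) = ie g (map E l).
  rewrite -H ?enum_uniq//; apply: eq_bigl => s; rewrite andb_idr// => _.
  by apply/fintype.subsetP => i _; rewrite inE mem_enum.
elim: l g => [|a l IH] g /=.
  move=> _; rewrite big1// => s /andP[s0 /fintype.subsetP sl]; case/negP: s0.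
  by apply/eqP/setP => i; rewrite finset.in_set0; apply/negP => /sl; rewrite inE.
move=> /andP[al ul].
rewrite (bigID (fun s : {set I} => a \in s)) /=.
rewrite [X in _ + X](_ : _ = ie g (map E l)); last first.
  rewrite -IH//; apply: eq_bigl => s; rewrite -andbA; congr (_ && _).
  apply/andP/idP => [[/fintype.subsetP sal as_]|/fintype.subsetP sl].
    apply/fintype.subsetP => i si; have := sal _ si; rewrite !inE => /orP[/eqP ia|//].
    by rewrite -ia si in as_.
  split; first by apply/fintype.subsetP => i /sl; rewrite !inE => ->; rewrite orbT.
  by apply/negP => /sl; rewrite inE (negbTE al).
rewrite (bigD1 [set a]%SET) /=; last first.
  rewrite !inE eqxx andbT; apply/andP; split.
    by apply/finset.set0Pn; exists a; rewrite inE.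
  by apply/fintype.subsetP => i; rewrite !inE => ->.
rewrite finset.cards1 sqrrN expr1n mul1r.
rewrite (_ : \bigcap_(_ in _) _ = E a); last first.
  apply/seteqP; split => [x /(_ a)|x Ex i /=]; first by apply; rewrite /= inE.
  by rewrite inE => /eqP ->.
rewrite -!addrA; congr (_ + _).
rewrite addrC; congr (_ + _).
rewrite -(IH (fun F => g (E a `&` F)))// -sumrN.
rewrite [LHS](reindex_onto (fun s => a |: s)%SET (fun s => s :\ a)%SET) /=; last first.
  by move=> s /andP[/andP[_ ?] _]; apply: finset.setD1K.
have pE s : (((a |: s != finset.set0) && (a |: s \subset [set i in a :: l])) &&
    (a \in a |: s) && (a |: s != [set a]) && ((a |: s) :\ a == s))%SET =
    (s != finset.set0) && (s \subset [set i in l]%SET).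
  apply/idP/idP.
    case/andP => /andP[/andP[/andP[_ /fintype.subsetP sub] _] ne] /eqP eqs.
    have as_ : a \notin s by rewrite -eqs !inE eqxx.
    apply/andP; split.
      by apply: contra ne => /eqP ->; rewrite finset.setU0.
    apply/fintype.subsetP => i si; have := sub i; rewrite !inE si orbT => /(_ isT).
    by case/orP => // /eqP ia; rewrite -ia si in as_.
  case/andP => /finset.set0Pn[i si] /fintype.subsetP sl.
  have as_ : a \notin s by apply/negP => /sl; rewrite inE (negbTE al).
  have ia : i != a by apply: contraNneq as_ => <-.
  rewrite finset.setU1K// eqxx andbT setU11 andbT; apply/andP; split.
    apply/andP; split; first by apply/finset.set0Pn; exists a; rewrite !inE eqxx.
    apply/fintype.subsetP => j; rewrite !inE => /orP[-> //|/sl]; rewrite inE => ->.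
    by rewrite orbT.
  apply/negP => /eqP /setP /(_ i); rewrite !inE si orbT => /esym.
  by rewrite (negbTE ia).
rewrite (eq_bigl _ _ pE); apply: eq_bigr => s /andP[_ /fintype.subsetP sl].
have as_ : a \notin s by apply/negP => /sl; rewrite inE (negbTE al).
rewrite cardsU1 as_ add1n exprS mulN1r mulNr; congr (- (_ * g _)).
apply/seteqP; split => [x H|x [Eax H] i /=].
  split; first by apply: H; rewrite /= !inE eqxx.
  by move=> i /= si; apply: H; rewrite /= !inE si orbT.
by rewrite !inE => /orP[/eqP ->//|si]; apply: H.
Qed.

End InclusionExclusionMap.

(** * Dimension and closed sets *)

Section Dimension.
Variables (M : choiceType) (G : pregeometry M).
Implicit Types (A B : {fset M}) (x : M) (Y Z E F : set M).

Lemma dimS A B : (A `<=` B)%fset -> G A <= G B.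
Proof.
move=> /fsetUidPr AB; suff H C : G A <= G (C `|` A)%fset by rewrite -AB fsetUC.
elim/fset1U_rect: C => [|x C _ IH]; first by rewrite fset0U.
rewrite -fsetUA; apply: (leq_trans IH).
by case/andP: (dim_step G (C `|` A)%fset x).
Qed.

Lemma dim_le_card A : G A <= #|` A|.
Proof.
elim/fset1U_rect: A => [|x A xA IH]; first by rewrite dim0.
rewrite cardfsU1 xA add1n; case/andP: (dim_step G A x) => _ /leq_trans.
by apply; rewrite ltnS.
Qed.

(** Submodularity applied to x |` A and B, whose intersection contains A. *)
Lemma fclS A B x : (A `<=` B)%fset -> fcl G A x -> fcl G B x.
Proof.
rewrite /fcl /= => AB xA; apply/eqP; rewrite eqn_leq andbC.
case/andP: (dim_step G B x) => -> _ /=.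
have := dim_submod G (x |` A)%fset B; rewrite -fsetUA (fsetUidPr _ _ AB) xA.
have := dimS (A := A) (B := (x |` A)%fset `&` B)%fset.
rewrite fsubsetI AB fsubsetU1 => /(_ isT).
lia.
Qed.

Lemma dim_fclU A B : [set` B] `<=` fcl G A -> G (B `|` A)%fset = G A.
Proof.
elim/fset1U_rect: B => [|x B _ IH] BA; first by rewrite fset0U.
have -> : G (x |` B `|` A)%fset = G (B `|` A)%fset.
  rewrite -fsetUA; apply: (@fclS A); first exact: fsubsetUr.
  by apply: BA; rewrite /= !inE eqxx.
by apply: IH => y yB; apply: BA; rewrite /= fset1Ur.
Qed.

Lemma fcl_le A B x : [set` B] `<=` fcl G A -> fcl G B x -> fcl G A x.
Proof.
move=> BA xB; have /= H := fclS (fsubsetUl B A) xB; rewrite /fcl /= in H *.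
rewrite [RHS](dim_fclU BA) in H.
apply/eqP; rewrite eqn_leq; case/andP: (dim_step G A x) => -> _; rewrite andbT.
by rewrite -H; apply: dimS; rewrite fsetUS// fsubsetUr.
Qed.

Lemma sub_fcl A : [set` A] `<=` fcl G A.
Proof. by move=> x xA; rewrite /fcl /= mem_fset1U. Qed.

Lemma exists_basis A : exists B, [/\ (B `<=` A)%fset, indep G B & G B = G A].
Proof.
elim/fset1U_rect: A => [|x A xA [B [BA iB GB]]].
  by exists fset0; rewrite /indep dim0 cardfs0.
have [xcl|xcl] := pselect (fcl G A x).
  exists B; split => //; last by rewrite GB [RHS]xcl.
  exact: fsubset_trans BA (fsubsetU1 _ _).
have xB : G (x |` B)%fset = (G B).+1.
  case/andP: (dim_step G B x); rewrite leq_eqVlt => /orP[/eqP/esym xB _|].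
    by case: xcl; apply: (fclS BA).
  by move=> ? ?; apply/eqP; rewrite eqn_leq; apply/andP.
exists (x |` B)%fset; split.
- by rewrite fsetUS.
- by rewrite /indep xB cardfsU1 iB (contra (fsubsetP BA x) xA).
- apply/eqP; rewrite eqn_leq dimS ?fsetUS//= xB GB.
  by case/andP: (dim_step G A x).
Qed.

Lemma sdim_max Y : finite_dim G Y ->
  exists A, [/\ [set` A] `<=` Y, indep G A & G A = sdim G Y].
Proof.
move=> fY; have := nat_supremums_neq0 fY => s0.
have n0 : indep_sizes G Y 0.
  by exists fset0; [split; [move=> x|rewrite /indep dim0 cardfs0]|rewrite cardfs0].
have [m [A [AY iA] <-] ubm] :
    exists2 m, indep_sizes G Y m & ubound (indep_sizes G Y) m.
  case: fY => b ub.
  have ex : exists n, `[< indep_sizes G Y n >] by exists 0; apply/asboolP.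
  have lb n : `[< indep_sizes G Y n >] -> n <= b by move=> /asboolP /ub.
  case: (ex_maxnP ex lb) => m /asboolP Ym mm; exists m => // j Yj.
  by apply: mm; apply/asboolP.
exists A; split => //; rewrite iA; rewrite /sdim /supremum ifF; last first.
  by apply/negP => /eqP e; rewrite e in n0.
case: xgetP => [y -> [uby lby]|/(_ #|` A|)]; last first.
  by case; split => // y; apply; exists A.
apply/eqP; rewrite eqn_leq; apply/andP; split; first by apply: uby; exists A.
exact: lby.
Qed.

Lemma le_sdim Y A : finite_dim G Y -> [set` A] `<=` Y -> G A <= sdim G Y.
Proof.
move=> fY AY; have [B [BA iB <-]] := exists_basis A; rewrite iB.
have ne := nat_supremums_neq0 fY.
apply: (ge_supremum_Nmem 0 ne); exists B => //; split => // x /= xB.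
by apply: AY; apply: (fsubsetP BA).
Qed.

Lemma sdim_le Y n : (forall A, [set` A] `<=` Y -> G A <= n) ->
  finite_dim G Y /\ sdim G Y <= n.
Proof.
move=> H; have fY : finite_dim G Y.
  by exists n => _ [A [AY iA] <-]; rewrite -iA; apply: H.
by split => //; have [A [AY _ <-]] := sdim_max fY; apply: H.
Qed.

Lemma sdim_eq Y A : [set` A] `<=` Y ->
  (forall B, [set` B] `<=` Y -> G B <= G A) -> sdim G Y = G A.
Proof.
move=> AY H; have [fY le] := sdim_le H.
by apply/eqP; rewrite eqn_leq le le_sdim.
Qed.

Lemma sdim_fset A : sdim G [set` A] = G A.
Proof. by apply: sdim_eq => // B BA; apply: dimS; apply/fsubsetP. Qed.

Lemma sdim_fcl A : sdim G (fcl G A) = G A.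
Proof.
apply: sdim_eq => [|B /dim_fclU <-]; first exact: sub_fcl.
by apply: dimS; apply: fsubsetUl.
Qed.

Lemma finite_dim_fcl A : finite_dim G (fcl G A).
Proof.
have [] // := @sdim_le (fcl G A) (G A).
by move=> B /dim_fclU <-; apply: dimS; apply: fsubsetUl.
Qed.

Lemma finite_dimS Y Z : Y `<=` Z -> finite_dim G Z -> finite_dim G Y.
Proof.
move=> YZ fZ; have [] // := @sdim_le Y (sdim G Z).
by move=> A AY; apply: le_sdim => //; apply: subset_trans YZ.
Qed.

Lemma sdimS Y Z : Y `<=` Z -> finite_dim G Z -> sdim G Y <= sdim G Z.
Proof.
move=> YZ fZ; have [A [AY _ <-]] := sdim_max (finite_dimS YZ fZ).
by apply: le_sdim => //; apply: subset_trans YZ.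
Qed.

Lemma is_closed_fcl E A x : is_closed G E -> [set` A] `<=` E -> fcl G A x -> E x.
Proof. by move=> cE AE xA; rewrite -cE; exists A. Qed.

Definition fdc E := is_closed G E /\ finite_dim G E.

Lemma fdc_fcl A : fdc (fcl G A).
Proof.
split; last exact: finite_dim_fcl.
apply/seteqP; split => [x [B /= BA xB]|x xA]; first exact: fcl_le xB.
have [B [BA _ GB]] := sdim_max (finite_dim_fcl A).
by exists A => //=; apply: sub_fcl.
Qed.

Lemma fcl_basis A E : finite_dim G E -> [set` A] `<=` E -> sdim G E <= G A ->
  E `<=` fcl G A.
Proof.
move=> fE AE le x Ex; rewrite /fcl /=; apply/eqP; rewrite eqn_leq.
case/andP: (dim_step G A x) => -> _; rewrite andbT (leq_trans _ le)// le_sdim//.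
by move=> y /=; rewrite !inE => /orP[/eqP -> //|]; apply: AE.
Qed.

(** A closed E that meets Y in a set of full dimension contains a basis of Y. *)
Lemma closed_sub E Y : finite_dim G Y -> is_closed G E ->
  sdim G Y <= sdim G (E `&` Y) -> Y `<=` E.
Proof.
move=> fY cE le; have fEY := finite_dimS (@subIsetr _ E Y) fY.
have [A [AEY _ GA]] := sdim_max fEY.
have AE : [set` A] `<=` E by move=> x /AEY [].
have AY : [set` A] `<=` Y by move=> x /AEY [].
by move=> x Yx; apply: (is_closed_fcl cE AE); apply: (fcl_basis fY AY); rewrite ?GA.
Qed.

Lemma fdc_basis E : fdc E -> exists2 A, [set` A] `<=` E /\ indep G A & E = fcl G A.
Proof.
move=> [cE fE]; have [A [AE iA GA]] := sdim_max fE; exists A => //.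
by apply/seteqP; split=> x; [apply: fcl_basis; rewrite ?GA|apply: is_closed_fcl].
Qed.

Lemma is_closedI E F : is_closed G E -> is_closed G F -> is_closed G (E `&` F).
Proof.
move=> cE cF; apply/seteqP; split => [x [A /= AEF xA]|x EFx].
  by split; [apply: (is_closed_fcl cE _ xA)|apply: (is_closed_fcl cF _ xA)];
    move=> y /AEF [].
exists [fset x]%fset; last by apply: sub_fcl; rewrite /= !inE.
by move=> y /=; rewrite inE => /eqP ->.
Qed.

Lemma fdcI E F : fdc E -> fdc F -> fdc (E `&` F).
Proof.
move=> [cE fE] [cF fF]; split; first exact: is_closedI.
exact: finite_dimS (@subIsetl _ E F) fE.
Qed.

Definition hull Y : set M := cl G Y.

Lemma hullE Y A : finite_dim G Y -> [set` A] `<=` Y -> sdim G Y <= G A ->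
  hull Y = fcl G A.
Proof.
move=> fY AY le; apply/seteqP; split => [x [B /= BY xB]|x xA]; last by exists A.
apply: (fcl_le _ xB) => y /BY; exact: fcl_basis.
Qed.

Lemma hullP Y : finite_dim G Y ->
  [/\ fdc (hull Y), Y `<=` hull Y & sdim G (hull Y) = sdim G Y].
Proof.
move=> fY; have [A [AY _ GA]] := sdim_max fY.
rewrite (@hullE Y A)// ?GA// sdim_fcl; split => //; first exact: fdc_fcl.
by apply: fcl_basis; rewrite ?GA.
Qed.

Lemma hull_sub Y E : is_closed G E -> Y `<=` E -> hull Y `<=` E.
Proof. by move=> cE YE x [A /= AY xA]; apply: (is_closed_fcl cE _ xA) => y /AY /YE. Qed.

Definition union_of (s : seq (set M)) : set M := [set x | exists2 E, E \in s & E x].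

Lemma union_of_cons E s : union_of (E :: s) = E `|` union_of s.
Proof.
apply/seteqP; split => x.
  by move=> [F]; rewrite inE => /orP[/eqP -> ?|Fs Fx]; [left|right; exists F].
case=> [Ex|[F Fs Fx]]; first by exists E; rewrite ?mem_head.
by exists F; rewrite // inE Fs orbT.
Qed.

Lemma union_of_nil : union_of [::] = set0.
Proof. by apply/seteqP; split => x // []. Qed.

Lemma finite_dim_union s : (forall E, E \in s -> finite_dim G E) ->
  finite_dim G (union_of s).
Proof.
move=> fs; suff [A sA] : exists A, union_of s `<=` fcl G A.
  exact: finite_dimS sA (finite_dim_fcl A).
elim: s fs => [|E s IH] fs; first by exists fset0; rewrite union_of_nil.
have fE := fs E (mem_head _ _).
have [A [AE _ GA]] := sdim_max fE.
have [|B sB] := IH; first by move=> F Fs; apply: fs; rewrite inE Fs orbT.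
exists (A `|` B)%fset; rewrite union_of_cons => x [Ex|/sB].
  by apply: (fclS (fsubsetUl A B)); apply: fcl_basis Ex; rewrite ?GA.
by apply: fclS; apply: fsubsetUr.
Qed.

End Dimension.

(** * Alternating sums, strong subsets and embeddings *)

Section AlternatingSum.
Variables (M : choiceType) (G : pregeometry M).
Implicit Types (s t : seq (set M)) (E F H Y : set M).
Local Open Scope ring_scope.

Definition alt s : int := ie (fun F => (sdim G F)%:Z) s.

(** The alternating sum of the traces of s on H, computed in G. For an embedding
    with range H it is the alternating sum of the preimages ([alt_preimage]), so
    subpregeometries can be replaced by their ranges. *)
Definition alt_in H s : int := ie (fun F => (sdim G (F `&` H))%:Z) s.

Definition all_fdc s := forall E, E \in s -> fdc G E.

Lemma Delta_alt k (E : 'I_k -> set M) : Delta G E = alt [seq E i | i <- enum 'I_k].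
Proof. exact: (ie_powerset E (fun F => (sdim G F)%:Z)). Qed.

End AlternatingSum.

Lemma map_nth_enum (T : Type) (x0 : T) (s : seq T) :
  [seq nth x0 s i | i : 'I_(size s) <- enum 'I_(size s)] = s.
Proof.
rewrite (_ : [seq _ | _ <- _] = map (nth x0 s) (map val (enum 'I_(size s)))).
  by rewrite val_enum_ord map_nth_iota0// take_size.
by rewrite -map_comp.
Qed.

Section Embeddings.
Variables (M N : choiceType) (G : pregeometry M) (K : pregeometry N) (f : M -> N).
Hypothesis f_emb : embedding G K f.
Let f_inj : injective f := proj1 f_emb.
Let f_dim A : K [fset f x | x in A]%fset = G A := proj2 f_emb A.

Lemma fset_preimage (h : M -> N) (B : {fset N}) : [set` B] `<=` range h ->
  exists A : {fset M}, [fset h x | x in A]%fset = B.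
Proof.
elim/fset1U_rect: B => [|y B _ IH] Bh; first by exists fset0; rewrite imfset0.
have [x _ xy] := Bh y (fset1U1 _ _).
have [|A AB] := IH; first by move=> z zB; apply: Bh; rewrite /= fset1Ur.
by exists (x |` A)%fset; rewrite imfsetU1 AB xy.
Qed.

Let f_card (A : {fset M}) : #|` [fset f x | x in A]%fset| = #|` A|.
Proof. by rewrite card_imfset. Qed.

Lemma embedding_fcl A x : fcl G A x <-> fcl K [fset f x | x in A]%fset (f x).
Proof. by rewrite /fcl /= -imfsetU1 !f_dim. Qed.

Lemma indep_sizes_preimage Y :
  indep_sizes G (f @^-1` Y) = indep_sizes K (Y `&` range f).
Proof.
apply/seteqP; split => [_ [A [AY iA] <-]|_ [B [BY iB] <-]].
  exists [fset f x | x in A]%fset; last by rewrite f_card.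
  split; last by rewrite /indep f_dim f_card.
  by move=> _ /imfsetP[x xA ->]; split; [apply: AY|exists x].
have [|A AB] := fset_preimage (h := f) (B := B); first by move=> x /BY [].
exists A; last by rewrite -AB f_card.
split; last by rewrite /indep -f_card AB -iB -AB f_dim.
move=> x xA; have /BY [] // : f x \in B.
by rewrite -AB; apply/imfsetP; exists x.
Qed.

Lemma sdim_preimage Y : sdim G (f @^-1` Y) = sdim K (Y `&` range f).
Proof. by rewrite /sdim indep_sizes_preimage. Qed.

Lemma finite_dim_preimage Y :
  finite_dim G (f @^-1` Y) <-> finite_dim K (Y `&` range f).
Proof. by rewrite /finite_dim indep_sizes_preimage. Qed.

Lemma alt_preimage s : alt G (map (preimage f) s) = alt_in K (range f) s.
Proof.
rewrite /alt ie_map; last by move=> E F; apply/seteqP; split.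
by apply: eq_ie => F /=; rewrite sdim_preimage.
Qed.

Lemma fdc_preimage E : fdc K E -> fdc G (f @^-1` E).
Proof.
move=> [cE fE]; split; last first.
  by apply/finite_dim_preimage; apply: finite_dimS fE; apply: subIsetl.
apply/seteqP; split => [x [A /= AE xA]|x Ex].
  apply: (is_closed_fcl cE _ ((embedding_fcl A x).1 xA)).
  by move=> _ /imfsetP[y yA ->]; apply: AE.
exists [fset x]%fset; last by apply: sub_fcl; rewrite /= inE.
by move=> y /=; rewrite inE => /eqP ->.
Qed.

Lemma fdc_image F : fdc G F -> exists E, [/\ fdc K E, f @^-1` E = F,
  sdim K E = sdim G F & sdim K (E `&` range f) = sdim K E].
Proof.
move=> /fdc_basis [A _ ->]; exists (fcl K [fset f x | x in A]%fset).
have pre : f @^-1` fcl K [fset f x | x in A]%fset = fcl G A.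
  by apply/seteqP; split => x /embedding_fcl.
split; rewrite ?sdim_fcl ?f_dim//; first exact: fdc_fcl.
by rewrite -sdim_preimage pre sdim_fcl.
Qed.

End Embeddings.

Lemma embedding_val (M : choiceType) (G : pregeometry M) (H : set M) :
  embedding (subpregeometry G H) G set_val.
Proof. by split; first exact: val_inj. Qed.

Lemma range_set_val (M : Type) (H : set M) : range (set_val : H -> M) = H.
Proof.
apply/seteqP; split => [_ [x _ <-]|x Hx]; first exact: set_valP.
by exists (exist _ x (mem_set Hx)).
Qed.

Section StrongLists.
Variables (M : choiceType) (G : pregeometry M).
Implicit Types (s t : seq (set M)) (E F H Y : set M) (r : nat).
Local Open Scope ring_scope.

Lemma strongP H :
  strong G H <-> forall s, all_fdc G s -> alt_in G H s <= alt G s.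
Proof.
have DH k (E : 'I_k -> set M) :
    Delta (subpregeometry G H) (fun i => set_val @^-1` E i) =
    alt_in G H [seq E i | i <- enum 'I_k].
  rewrite Delta_alt.
  have -> : [seq set_val @^-1` E i | i <- enum 'I_k] =
      map (preimage (set_val : H -> M)) [seq E i | i <- enum 'I_k].
    by rewrite -map_comp.
  by rewrite (alt_preimage (embedding_val G H)) range_set_val.
split => [sH s cs|H' k E cE]; last first.
  rewrite DH Delta_alt; apply: H' => F /mapP[i _ ->]; apply: cE.
have := sH (size s) (fun i => nth set0 s i); rewrite DH Delta_alt map_nth_enum.
by apply => i; apply: cs; apply: mem_nth.
Qed.

Lemma flatP :
  flat G <-> forall s, all_fdc G s -> (sdim G (union_of s))%:Z <= alt G s.
Proof.
have U k (E : 'I_k -> set M) :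
    \bigcup_i E i = union_of [seq E i | i <- enum 'I_k].
  apply/seteqP; split => [x [i _ Ex]|x [F /mapP[i _ ->] Ex]]; last by exists i.
  by exists (E i) => //; apply: map_f; rewrite mem_enum.
split => [fG s cs|H' k E cE]; last first.
  rewrite U Delta_alt; apply: H' => F /mapP[i _ ->]; apply: cE.
have := fG (size s) (fun i => nth set0 s i); rewrite U Delta_alt map_nth_enum.
by apply => i; apply: cs; apply: mem_nth.
Qed.

(** Strength is proved by induction on r: two distinct closed sets of dimension
    r.+1 meet in dimension at most r. *)
Definition strong_upto r H := forall s, all_fdc G s ->
  (forall E, E \in s -> (sdim G E <= r)%N) -> alt_in G H s <= alt G s.

Lemma strong_strong_upto r H : strong G H -> strong_upto r H.
Proof. by move=> /strongP sH s cs _; apply: sH. Qed.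

Lemma strong_upto_strong H : (forall r, strong_upto r H) -> strong G H.
Proof.
move=> sH; apply/strongP => s cs.
suff [r sr] : exists r, forall E, E \in s -> (sdim G E <= r)%N by apply: (sH r).
elim: s {cs} => [|E s [r sr]]; first by exists 0%N.
exists (maxn r (sdim G E)) => F; rewrite inE leq_max => /orP[/eqP ->|/sr -> //].
by rewrite leqnn orbT.
Qed.

Lemma alt_in_trace H s t : map (fun E => E `&` H) s = map (fun E => E `&` H) t ->
  alt_in G H s = alt_in G H t.
Proof.
have capI E F : (E `&` F) `&` H = (E `&` H) `&` (F `&` H).
  by rewrite setIACA setIid.
have alt_inE u : alt_in G H u =
    ie (fun F => (sdim G F)%:Z) (map (fun E => E `&` H) u).
  by rewrite ie_map.
by rewrite !alt_inE => ->.
Qed.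

(** The inequality of strength for two sets spanned by H says that H spans their
    intersection. So the sets spanned by H are closed under intersection, and on
    them the dimension is unchanged by restriction to H. *)
Lemma strong_spanned H r s : strong_upto r H -> all_fdc G s ->
  (forall E, E \in s -> (sdim G E <= r)%N /\ sdim G (E `&` H) = sdim G E) ->
  alt_in G H s = alt G s.
Proof.
move=> sH cs ss; pose K E := [/\ fdc G E, (sdim G E <= r)%N &
  sdim G (E `&` H) = sdim G E].
apply: (@ie_ext _ K) => [E F [cE rE EH] [cF rF FH]|E [_ _ ->]//|E Es]; last first.
  by have [] := ss _ Es; split => //; apply: cs.
have cEF := fdcI cE cF; split => //.
  by apply: leq_trans rE; apply: sdimS; [apply: subIsetl|case: cE].
apply/eqP; rewrite eqn_leq sdimS ?andTb; [|exact: subIsetl|by case: cEF].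
have ie2 (f : set M -> int) : ie f [:: E; F] = f E + f F - f (E `&` F).
  by rewrite /= !(subr0, addr0).
have : alt_in G H [:: E; F] <= alt G [:: E; F].
  by apply: sH => X; rewrite !inE => /orP[] /eqP ->.
by rewrite /alt_in /alt !ie2 EH FH; lia.
Qed.

(** Replacing E by the closure of its trace on H leaves the trace unchanged and
    makes E spanned by H; this is how [strong_spanned] applies to any family. *)
Definition hulls H s := [seq hull G (E `&` H) | E <- s].

Lemma hullsP H E : fdc G E ->
  [/\ fdc G (hull G (E `&` H)), hull G (E `&` H) `&` H = E `&` H,
      sdim G (hull G (E `&` H)) = sdim G (E `&` H) & hull G (E `&` H) `<=` E].
Proof.
move=> [cE fE]; have fEH := finite_dimS (@subIsetl _ E H) fE.
have [c1 sub d] := hullP fEH.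
have subE : hull G (E `&` H) `<=` E by apply: hull_sub => // x [].
split => //; apply/seteqP; split => x [Ex Hx]; split => //; first exact: subE.
exact: sub.
Qed.

Lemma alt_in_hulls H s : all_fdc G s -> alt_in G H (hulls H s) = alt_in G H s.
Proof.
move=> cs; apply: alt_in_trace; rewrite -map_comp; apply/eq_in_map => E Es /=.
by have [] := hullsP H (cs _ Es).
Qed.

Lemma alt_hulls H r s : strong_upto r H -> all_fdc G s ->
  (forall E, E \in s -> (sdim G (E `&` H) <= r)%N) ->
  alt G (hulls H s) = alt_in G H s.
Proof.
move=> sH cs rs; rewrite -alt_in_hulls//; symmetry.
apply: (strong_spanned sH) => X /mapP[E Es ->];
  have [// c1 e1 e2 _] := hullsP H (cs _ Es).
by rewrite e1 e2; split => //; apply: rs.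
Qed.

Lemma alt_spanned H s : strong G H -> all_fdc G s ->
  (forall E, E \in s -> sdim G (E `&` H) = sdim G E) -> alt_in G H s = alt G s.
Proof.
move=> sH cs ss; pose r := \max_(E <- s) sdim G E.
apply: (@strong_spanned _ r) => //; first exact: strong_strong_upto.
by move=> E Es; split; [rewrite /r (big_rem E)//= leq_maxl|apply: ss].
Qed.

Lemma all_fdc_hulls H s : all_fdc G s -> all_fdc G (hulls H s).
Proof. by move=> cs X /mapP[E Es ->]; have [] := hullsP H (cs _ Es). Qed.

Lemma alt_hulls_strong H s : strong G H -> all_fdc G s ->
  alt G (hulls H s) = alt_in G H s.
Proof.
move=> sH cs; rewrite -alt_in_hulls//; symmetry; apply: alt_spanned => //.
  exact: all_fdc_hulls.
by move=> X /mapP[E Es ->]; have [_ -> -> _] := hullsP H (cs _ Es).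
Qed.

Lemma sub_union_hulls H s : all_fdc G s -> union_of s `&` H `<=` union_of (hulls H s).
Proof.
move=> cs x [[E Es Ex] Hx]; exists (hull G (E `&` H)); first exact: map_f.
have [_ e _ _] := hullsP H (cs _ Es).
by have [] : (hull G (E `&` H) `&` H) x by rewrite e; split.
Qed.

End StrongLists.

Section StrongEmbeddings.
Variables (M N : choiceType) (G : pregeometry M) (K : pregeometry N) (f : M -> N).
Hypothesis f_emb : embedding G K f.
Local Open Scope ring_scope.

Lemma fdc_lift s : all_fdc G s -> exists t, [/\ all_fdc K t,
  map (preimage f) t = s &
  forall E, E \in t -> sdim K (E `&` range f) = sdim K E].
Proof.
elim: s => [|E s IH] cs; first by exists [::].
have [|t [ct ts dt]] := IH; first by move=> F Fs; apply: cs; rewrite inE Fs orbT.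
have [F [cF FE _ dF]] := fdc_image f_emb (cs E (mem_head _ _)).
exists (F :: t); rewrite /= FE ts; split => // X;
  by rewrite inE => /orP[/eqP ->|]; [|auto].
Qed.

(** For families spanned by the range the alternating sums upstairs and
    downstairs agree, so flatness restricts to strong subsets. *)
Lemma flat_embedding : flat K -> strong K (range f) -> flat G.
Proof.
move=> /flatP fK sf; apply/flatP => s cs; have [t [ct ts dt]] := fdc_lift cs.
rewrite -{2}ts (alt_preimage f_emb) (alt_spanned sf)//.
apply: (le_trans _ (fK _ ct)); rewrite lez_nat.
have -> : union_of s = f @^-1` union_of t.
  apply/seteqP; split => x; rewrite -ts.
    by move=> [_ /mapP[F Ft ->] Fx]; exists F.
  by move=> [F Ft Fx]; exists (f @^-1` F) => //; apply: map_f.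
rewrite (sdim_preimage f_emb); apply: sdimS; first exact: subIsetl.
by apply: finite_dim_union => E /ct [].
Qed.

(** If both the image of H and the whole range are strong then so is H below. *)
Lemma strong_preimage H : strong K (range f) -> strong K (f @` H) -> strong G H.
Proof.
move=> sf sH; apply/strongP => s cs; have [t [ct ts dt]] := fdc_lift cs.
rewrite -ts (alt_preimage f_emb) (alt_spanned sf)//.
apply: (le_trans _ ((strongP _ _).1 sH t ct)); rewrite /alt_in ie_map; last first.
  by move=> E F; apply/seteqP; split.
rewrite le_eqVlt; apply/orP; left; apply/eqP; apply: eq_ie => F /=.
rewrite (_ : f @^-1` F `&` H = f @^-1` (F `&` f @` H)); last first.
  apply/seteqP; split => x [Fx]; first by move=> Hx; split => //; exists x.
  by move=> [y Hy /(proj1 f_emb) yx]; split => //; rewrite -yx.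
rewrite (sdim_preimage f_emb); congr (sdim K _)%:Z.
apply/seteqP; split => [y [] //|y [Fy Hy]]; split => //.
by case: Hy => x Hx <-; exists x.
Qed.

End StrongEmbeddings.

(** * Finite strong closures in a flat pregeometry *)

Section StrongClosure.
Variables (M : choiceType) (G : pregeometry M).
Hypothesis G_flat : flat G.
Implicit Types (s t u : seq (set M)) (D E F H : set M) (X Y Z : {fset M}) (r : nat).
Local Open Scope ring_scope.

Definition rlist r s :=
  all_fdc G s /\ forall E, E \in s -> (sdim G E <= r)%N.

Lemma rlist_cat r s t : rlist r s -> rlist r t -> rlist r (s ++ t).
Proof.
by move=> [cs rs] [ct rt]; split=> E; rewrite mem_cat => /orP[]; auto.
Qed.

Lemma rlist_cons r E s : rlist r (E :: s) -> [/\ fdc G E, (sdim G E <= r)%N & rlist r s].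
Proof.
move=> [cs rs]; split; [apply: cs|apply: rs|]; rewrite ?mem_head//.
by split=> F Fs; [apply: cs|apply: rs]; rewrite inE Fs orbT.
Qed.

Lemma union_of_cat s t : union_of (s ++ t) = union_of s `|` union_of t.
Proof.
by elim: s => [|E s IH]; rewrite ?union_of_nil ?set0U// cat_cons !union_of_cons IH setUA.
Qed.

Lemma alt_ge0 s : all_fdc G s -> 0 <= alt G s.
Proof. by move=> cs; apply: (le_trans _ ((flatP _).1 G_flat s cs)). Qed.

(** The least alternating sum of a cover of H by closed sets of dimension at most
    r is the dimension that H would have if only the dependencies of rank at most
    r were kept. *)
Definition optimal r H s := [/\ rlist r s, H `<=` union_of s &
  forall t, rlist r t -> H `<=` union_of t -> alt G s <= alt G t].

Lemma exists_optimal r X : (0 < r)%N -> exists s, optimal r [set` X] s.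
Proof.
move=> r0; pose P n := `[< exists s, [/\ rlist r s, [set` X] `<=` union_of s &
  alt G s = n%:Z] >].
have exP : exists n, P n.
  pose s := [seq fcl G [fset x]%fset | x <- X].
  have rs : rlist r s.
    split=> _ /mapP[x _ ->]; first exact: fdc_fcl.
    rewrite sdim_fcl; apply: leq_trans r0.
    by apply: leq_trans (dim_le_card _ _) _; rewrite cardfs1.
  exists `|alt G s|%N; apply/asboolP; exists s; split => //.
    move=> x xX; exists (fcl G [fset x]%fset); first exact: map_f.
    by apply: sub_fcl; rewrite /= inE.
  by rewrite gez0_abs// alt_ge0//; case: rs.
case: (ex_minnP exP) => n /asboolP[s [rs cs sn]] nmin; exists s; split => // t rt ct.
have t0 : 0 <= alt G t by apply: alt_ge0; case: rt.
rewrite sn -(gez0_abs t0) lez_nat; apply: nmin; apply/asboolP; exists t.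
by rewrite gez0_abs.
Qed.

Lemma optimalS r H H' s : optimal r H s -> H `<=` H' -> H' `<=` union_of s ->
  optimal r H' s.
Proof.
move=> [rs cs os] HH' cs'; split => // t rt ct; apply: os => //.
exact: subset_trans ct.
Qed.

Lemma rlistW r r' s : (r <= r')%N -> rlist r s -> rlist r' s.
Proof. by move=> rr' [cs rs]; split => // E /rs /leq_trans; apply. Qed.

(** A cover of H by sets of dimension at most r can be refined by an optimal cover
    t for r.+1 without loss: s ++ t still costs at least as much as t, so by
    modularity the pairwise intersections cost at most as much as s. *)
Lemma optimal_refine r H s t : optimal r.+1 H t -> optimal r H s ->
  optimal r H (isects s t).
Proof.
move=> [rt ct ot] [rs cs os]; split.
- split=> _ /isectsP[E [F [Es Ft ->]]].
    by apply: fdcI; [case: rs => + _; apply|case: rt => + _; apply].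
  case: rs => fs /(_ _ Es); apply: leq_trans; apply: sdimS; first exact: subIsetl.
  by have [] := fs _ Es.
- move=> x Hx; have [E Es Ex] := cs _ Hx; have [F Ft Fx] := ct _ Hx.
  exists (E `&` F); last by [].
  by apply/allpairsP; exists (E, F).
- move=> u ru cu; apply: le_trans (os _ ru cu).
  have : alt G t <= alt G (s ++ t).
    apply: ot; first by apply: rlist_cat => //; apply: rlistW rs.
    by rewrite union_of_cat => x /cs; left.
  by have := ie_modular (fun F => (sdim G F)%:Z) s t; rewrite -!/(alt G _); lia.
Qed.

Lemma finite_spanning_set s : all_fdc G s -> exists Z, [set` Z] `<=` union_of s /\
  forall H, [set` Z] `<=` H -> alt_in G H s = alt G s /\
    forall E, E \in s -> sdim G (E `&` H) = sdim G E.
Proof.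
move=> cs; suff [Z [Zs ZP]] : exists Z, [set` Z] `<=` union_of s /\
    forall H, [set` Z] `<=` H ->
    ie (fun F => (sdim G ((setT `&` F) `&` H))%:Z) s =
      ie (fun F => (sdim G (setT `&` F))%:Z) s /\
    forall E, E \in s -> sdim G ((setT `&` E) `&` H) = sdim G (setT `&` E).
  exists Z; split => // H /ZP[e1 e2]; split => [|E /e2]; last by rewrite setTI.
  have -> : alt_in G H s = ie (fun F => (sdim G ((setT `&` F) `&` H))%:Z) s.
    by apply: eq_ie => F; rewrite setTI.
  by rewrite e1; apply: eq_ie => F; rewrite setTI.
elim: s cs setT => [|E s IH] cs D.
  by exists fset0; split => [x //|H _]; split.
have {}IH := IH (fun F Fs => cs F (mem_behead (s := E :: s) Fs)).
have fE : finite_dim G E by have [] := cs E (mem_head _ _).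
have fDE := finite_dimS (@subIsetr _ D E) fE.
have [A [AE _ GA]] := sdim_max fDE.
have [Z1 [Z1s Z1P]] := IH D; have [Z2 [Z2s Z2P]] := IH (D `&` E).
exists (A `|` (Z1 `|` Z2))%fset; split.
  by move=> x /=; rewrite !inE union_of_cons => /or3P[/AE[]|/Z1s|/Z2s]; by [left|right].
move=> H ZH.
have [|e1 d1] := Z1P H; first by move=> x xZ; apply: ZH; rewrite /= !inE [x \in Z1]xZ orbT.
have [|e2 _] := Z2P H; first by move=> x xZ; apply: ZH; rewrite /= !inE [x \in Z2]xZ !orbT.
have d0 : sdim G ((D `&` E) `&` H) = sdim G (D `&` E).
  apply/eqP; rewrite eqn_leq sdimS//= -GA; apply: le_sdim.
    exact: finite_dimS (@subIsetl _ _ H) fDE.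
  move=> x xA; split; first exact: AE.
  by apply: ZH; rewrite /= !inE [x \in A]xA.
split=> [/=|F]; last by rewrite inE => /orP[/eqP ->|/d1].
rewrite d0 e1; congr (_ - _).
have -> : ie (fun F => (sdim G (D `&` (E `&` F)))%:Z) s =
          ie (fun F => (sdim G (D `&` E `&` F))%:Z) s.
  by apply: eq_ie => F; rewrite setIA.
by rewrite -e2; apply: eq_ie => F; rewrite setIA.
Qed.

Definition spans_optimal_cover r H := exists s, [/\ optimal r H s, alt_in G H s = alt G s &
  forall E, E \in s -> sdim G (E `&` H) = sdim G E].

(** The trace on H of a closed F of dimension at most r.+1 is flat. Unless one
    member of s contains the trace, all members meet it in dimension at most r;
    there strength identifies alternating sums on H with sums in G, and G is
    flat. *)
Lemma local_flat r H F s : strong_upto G r H -> fdc G F -> (sdim G F <= r.+1)%N ->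
  all_fdc G s -> F `&` H `<=` union_of s ->
  (sdim G (F `&` H))%:Z <= ie (fun E => (sdim G ((F `&` E) `&` H))%:Z) s.
Proof.
move=> sH cF rF cs cov; have fF := proj2 cF.
have fFH := finite_dimS (@subIsetl _ F H) fF.
have [[E Es FE]|nE] := pselect (exists2 E, E \in s & F `&` H `<=` E).
  have <- : ie (fun E => (sdim G ((F `&` H) `&` E))%:Z) s = (sdim G (F `&` H))%:Z.
    by rewrite (ie_absorb (fun D => (sdim G D)%:Z))//; exists E.
  by rewrite le_eqVlt; apply/orP; left; apply/eqP; apply: eq_ie => X; rewrite setIAC.
pose t := [seq F `&` E | E <- s].
have ct : all_fdc G t by move=> _ /mapP[E Es ->]; apply: fdcI => //; apply: cs.
have rt E : E \in t -> (sdim G (E `&` H) <= r)%N.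
  move=> /mapP[X Xs ->]; rewrite leqNgt; apply/negP => lt; case: nE; exists X => //.
  have [cX _] := cs _ Xs; apply: closed_sub fFH cX _.
  rewrite (_ : X `&` (F `&` H) = F `&` X `&` H); last by rewrite setIA (setIC X).
  by apply: leq_trans lt; apply: leq_trans rF; apply: sdimS fF; apply: subIsetl.
rewrite -[leRHS](ie_setI (fun E => (sdim G (E `&` H))%:Z)) -/t -/(alt_in G H t).
rewrite -(alt_hulls sH)//.
apply: (le_trans _ ((flatP _).1 G_flat _ (all_fdc_hulls (H := H) ct))).
rewrite lez_nat; apply: sdimS.
  move=> x [Fx Hx]; apply: (sub_union_hulls ct); split => //.
  have [//|E Es Ex] := cov x; exists (F `&` E) => //; exact: map_f.
by apply: finite_dim_union => E /(all_fdc_hulls ct)[].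
Qed.

(** The trace on H is strong in a closed F of dimension at most r.+1: unless a
    member of s contains F, all members meet F in dimension at most r. *)
Lemma local_strong r H F s : strong_upto G r H -> fdc G F -> (sdim G F <= r.+1)%N ->
  all_fdc G s -> sdim G (F `&` H) = sdim G F ->
  ie (fun E => (sdim G ((F `&` E) `&` H))%:Z) s <=
  ie (fun E => (sdim G (F `&` E))%:Z) s.
Proof.
move=> sH cF rF cs spF; have fF := proj2 cF.
have [[E Es FE]|nE] := pselect (exists2 E, E \in s & F `<=` E).
  rewrite (ie_absorb (fun D => (sdim G D)%:Z)); last by exists E.
  rewrite (ie_absorb (fun D => (sdim G (D `&` H))%:Z)); last by exists E.
  by rewrite spF.
rewrite -(ie_setI (fun E => (sdim G E)%:Z)).
rewrite -(ie_setI (fun E => (sdim G (E `&` H))%:Z)); apply: sH.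
  by move=> _ /mapP[E Es ->]; apply: fdcI => //; apply: cs.
move=> _ /mapP[X Xs ->]; rewrite leqNgt; apply/negP => lt; case: nE; exists X => //.
have [cX _] := cs _ Xs; apply: closed_sub fF cX _.
by rewrite (setIC X) (leq_trans rF).
Qed.

(** Let u be an optimal cover of H realised in H. By [local_strong], a family s
    violating strength still violates it after the members of u are added. By
    [local_flat], adding s to u does not increase the sum in H. Hence u ++ s would
    be a cover of H cheaper than u. *)
Lemma strong_upto_step r H : strong_upto G r H -> spans_optimal_cover r.+1 H ->
  strong_upto G r.+1 H.
Proof.
move=> sH [u [[ru cu ou] eu du]] s cs rs; rewrite leNgt; apply/negP => viol.
have lt_us : alt G (u ++ s) < alt_in G H (u ++ s).
  elim: u ru du {cu ou eu} => //= F u IH /rlist_cons[cF rF ru] du.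
  have {}IH := IH ru (fun E Eu => du E (mem_behead (s := F :: u) Eu)).
  have cus : all_fdc G (u ++ s) by have [] := rlist_cat ru (conj cs rs).
  have := local_strong sH cF rF cus (du F (mem_head _ _)).
  rewrite /alt /alt_in /= (du F (mem_head _ _)) -!/(alt _ _) -!/(alt_in _ _ _).
  by move: IH; rewrite /alt /alt_in; lia.
have le_su : alt_in G H (s ++ u) <= alt_in G H u.
  have {viol lt_us} : rlist r.+1 s by [].
  elim: s {cs rs} => //= F s IH /rlist_cons[cF rF rs].
  have cus : all_fdc G (s ++ u) by have [] := rlist_cat rs ru.
  have cov : F `&` H `<=` union_of (s ++ u).
    by rewrite union_of_cat => x [_ /cu]; right.
  have := local_flat sH cF rF cus cov; move: (IH rs).
  by rewrite /alt_in /=; lia.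
have : alt G u <= alt G (u ++ s).
  apply: ou; first exact: rlist_cat.
  by rewrite union_of_cat => x /cu; left.
have : alt_in G H (u ++ s) = alt_in G H (s ++ u) by apply: ie_catC.
by move: lt_us le_su; rewrite eu; lia.
Qed.

Lemma strong_upto0 H : strong_upto G 0 H.
Proof.
move=> s cs s0; rewrite le_eqVlt; apply/orP; left; apply/eqP.
apply: (@ie_ext _ (fun E => finite_dim G E /\ sdim G E = 0%N)).
- move=> E F [fE E0] _; split; first exact: finite_dimS (@subIsetl _ _ _) fE.
  by apply/eqP; rewrite -leqn0 -E0 sdimS.
- move=> E [fE E0]; rewrite E0; congr Posz; apply/eqP.
  by rewrite -leqn0 -E0 sdimS.
- by move=> E Es; have [] := cs _ Es; have := s0 _ Es; rewrite leqn0 => /eqP.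
Qed.

(** Going down from r to 1: choose an optimal cover, refined by the previous one,
    and add finitely many points that span all its intersections. Points added
    later stay inside the refined covers, so no earlier cover is spoiled. *)
Lemma spans_optimal_cover_extension r X t : optimal r.+1 [set` X] t ->
  exists Y, [/\ (X `<=` Y)%fset, [set` Y] `<=` union_of t &
    forall j, (0 < j <= r)%N -> spans_optimal_cover j [set` Y]].
Proof.
elim: r X t => [|r IH] X t ot.
  exists X; split => //; first by case: ot.
  by move=> j /andP[]; case: j.
have [s os] := exists_optimal X (ltn0Sn r).
have {}os := optimal_refine ot os; set s' := isects s t in os.
have [[cs' rs'] cov _] := os.
have [Z [Zs ZP]] := finite_spanning_set cs'.
have cov' : [set` (X `|` Z)%fset] `<=` union_of s'.
  by move=> x /=; rewrite inE => /orP[/cov|/Zs].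
have os' : optimal r.+1 [set` (X `|` Z)%fset] s'.
  by apply: optimalS os _ cov' => x /= xX; rewrite inE xX.
have [Y [XZY Ys gY]] := IH _ _ os'.
have XZ x : x \in (X `|` Z)%fset -> x \in Y by apply/fsubsetP.
exists Y; split.
- by apply: fsubset_trans XZY; apply: fsubsetUl.
- move=> x /Ys [E /isectsP[E1 [E2 [_ E2t ->]]] [_ E2x]]; by exists E2.
- move=> j /andP[j0]; rewrite leq_eqVlt => /orP[/eqP ->|jr]; last first.
    by apply: gY; rewrite j0.
  have [|e d] := ZP [set` Y]; first by move=> x xZ; apply: XZ; rewrite inE [x \in Z]xZ orbT.
  by exists s'; split => //; apply: optimalS os' _ Ys.
Qed.

(** From the dimension of X upwards, the closure of X alone is an optimal cover,
    by flatness; below, [spans_optimal_cover_extension] provides the covers. *)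
Lemma finite_strong_closure X : exists2 Y, (X `<=` Y)%fset & strong G [set` Y].
Proof.
have topt r H : (G X <= r)%N -> [set` X] `<=` H -> H `<=` fcl G X ->
    optimal r H [:: fcl G X].
  move=> rX XH HX; split.
  - by split=> E; rewrite inE => /eqP ->; [apply: fdc_fcl|rewrite sdim_fcl].
  - by move=> x Hx; exists (fcl G X); rewrite ?mem_head//; apply: HX.
  - move=> t [ct _] cov; apply: (le_trans _ ((flatP _).1 G_flat t ct)).
    rewrite /alt /= subr0 addr0 sdim_fcl lez_nat; apply: le_sdim.
      by apply: finite_dim_union => E /ct[].
    exact: subset_trans cov.
have [Y [XY Yc gY]] := spans_optimal_cover_extension
  (topt _ _ (leqnSn _) (@subset_refl _ _) (@sub_fcl _ G X)).
have XY' : [set` X] `<=` [set` Y] by move=> x; apply/fsubsetP.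
have {}Yc : [set` Y] `<=` fcl G X.
  by move=> x /Yc[E]; rewrite inE => /eqP ->.
have all_span j : (0 < j)%N -> spans_optimal_cover j [set` Y].
  move=> j0; have [jX|/ltnW Xj] := leqP j (G X); first by apply: gY; rewrite j0.
  have dY : sdim G (fcl G X `&` [set` Y]) = sdim G (fcl G X).
    rewrite (setIidr Yc) sdim_fcl sdim_fset; apply/eqP; rewrite eqn_leq (dimS G XY) andbT.
    by rewrite -(sdim_fcl G X) le_sdim//; apply: finite_dim_fcl.
  exists [:: fcl G X]; split; first exact: topt.
    by rewrite /alt_in /alt /= dY.
  by move=> E; rewrite inE => /eqP ->.
exists Y => //; apply: strong_upto_strong; elim => [|r IH]; first exact: strong_upto0.
by apply: strong_upto_step IH (all_span _ _).
Qed.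

End StrongClosure.

(** * Relative predimension of a strong subset *)

Section Weights.
Variable T : finType.
Implicit Types (E F Y Z : set T) (s : seq (set T)) (e : {set T}) (mu : {set T} -> int).
Local Open Scope ring_scope.

Definition mass mu Y : int := \sum_e mu e * `[< [set` e] `<=` Y >]%:Z.

Definition sets_of (P : set T -> Prop) : seq (set T) :=
  [seq [set` e] | e : {set T} <- enum {set T} & `[< P [set` e] >]].

Lemma set_finset Y : exists e : {set T}, [set` e] = Y.
Proof.
by exists [set x | `[< Y x >]]%SET; apply/seteqP; split => x /=;
  rewrite inE => /asboolP.
Qed.

Lemma sets_ofP P E : E \in sets_of P <-> P E.
Proof.
split=> [/mapP[e + ->]|PE]; first by rewrite mem_filter => /andP[/asboolP].
have [e eE] := set_finset E; apply/mapP; exists e => //.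
by rewrite mem_filter mem_enum andbT; apply/asboolP; rewrite eE.
Qed.

Lemma ie_mass mu s :
  ie (mass mu) s = \sum_e mu e * `[< exists2 E, E \in s & [set` e] `<=` E >]%:Z.
Proof.
rewrite /mass ie_sum; apply: eq_bigr => e _.
by rewrite (ieZ _ (fun E => `[< [set` e] `<=` E >]%:Z)) ie_subset.
Qed.

(** Weights on the sets in K determine and are determined by their sums below
    the sets in K; they are built by induction on cardinality. *)
Lemma moebius_inversion (K : set T -> Prop) (h : set T -> int) : exists mu,
  (forall e, ~ K [set` e] -> mu e = 0) /\ forall Y, K Y -> h Y = mass mu Y.
Proof.
suff [mu [mu0 _ muh]] : exists mu, [/\ forall e, ~ K [set` e] -> mu e = 0,
    forall e, (#|T|.+1 <= #|e|)%N -> mu e = 0 &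
    forall e, K [set` e] -> (#|e| < #|T|.+1)%N -> h [set` e] = mass mu [set` e]].
  exists mu; split => // Y; have [e <-] := set_finset Y => Ke.
  by apply: muh; rewrite // ltnS max_card.
elim: #|T|.+1 => [|n [mu [mu0 mun muh]]].
  exists (fun=> 0); split => // e.
pose mu' e := if (#|e| == n) && `[< K [set` e] >] then h [set` e] - mass mu [set` e]
  else mu e.
have sub e e' : `[< [set` e'] `<=` [set` e] >] = (e' \subset e).
  by apply/asboolP/fintype.subsetP => H x; apply: H.
exists mu'; split.
- by move=> e nK; rewrite /mu' (asboolF nK) andbF mu0.
- by move=> e ne; rewrite /mu' gtn_eqF//= mun// ltnW.
- move=> e Ke; rewrite ltnS leq_eqVlt => /orP[/eqP en|en].
    rewrite /mass (bigD1 e)//= sub subxx mulr1 /mu' en eqxx (asboolT Ke) /=.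
    rewrite /mass (bigD1 e)//= sub subxx mun ?en// mul0r add0r.
    rewrite [X in _ + X](_ : _ = \sum_(e' | e' != e) mu e' * `[< [set` e'] `<=` [set` e] >]%:Z).
      by rewrite subrK.
    apply: eq_bigr => e' ne; rewrite sub; case: ifPn => // /andP[/eqP e'n _].
    case: (boolP (e' \subset e)) => [e'e|]; last by rewrite !mulr0.
    by case/negP: ne; rewrite eqEcard e'e e'n en leqnn.
  rewrite muh//; apply: eq_bigr => e' _; rewrite sub.
  case: (boolP (e' \subset e)) => [e'e|]; last by rewrite !mulr0.
  by rewrite /mu' ltn_eqF//; apply: leq_ltn_trans en; apply: subset_leq_card.
Qed.

Lemma ie_moebius (K : set T -> Prop) (h : set T -> int) mu s :
  (forall E F, K E -> K F -> K (E `&` F)) ->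
  (forall Y, K Y -> h Y = mass mu Y) -> (forall E, E \in s -> K E) ->
  ie h s = \sum_e mu e * `[< exists2 E, E \in s & [set` e] `<=` E >]%:Z.
Proof. by move=> KI hm Ks; rewrite -ie_mass; apply: (@ie_ext _ K). Qed.

Definition outside (b Y : set T) : int := \sum_x (~~ `[< b x >])%:Z * `[< Y x >]%:Z.

Lemma outside_mono b Y Z : Y `<=` Z -> outside b Y <= outside b Z.
Proof.
move=> YZ; apply: ler_sum => x _; apply: ler_wpM2l => //.
by rewrite lez_nat; case: asboolP => // /YZ Zx; rewrite asboolT.
Qed.

Lemma outsideUI b Y Z : outside b (Y `|` Z) + outside b (Y `&` Z) =
  outside b Y + outside b Z.
Proof.
rewrite -!big_split; apply: eq_bigr => x _ /=; rewrite -!mulrDr; congr (_ * _).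
have -> : `[< (Y `|` Z) x >] = `[< Y x >] || `[< Z x >] by rewrite -asbool_or.
have -> : `[< (Y `&` Z) x >] = `[< Y x >] && `[< Z x >] by rewrite -asbool_and.
by case: `[< Y x >]; case: `[< Z x >].
Qed.

Lemma outside_sub b Y : Y `<=` b -> outside b Y = 0.
Proof.
move=> Yb; rewrite /outside big1// => x _.
by have [/Yb bx|nY] := pselect (Y x); 
  [rewrite (asboolT bx) mul0r|rewrite (asboolF nY) mulr0].
Qed.

Lemma outside1 b x : outside b [set x] = (~~ `[< b x >])%:Z.
Proof.
rewrite /outside (bigD1 x)//= (@asboolT (x = x))// mulr1 big1 ?addr0// => y yx.
by rewrite (@asboolF (y = x)) ?mulr0// => /eqP; rewrite (negbTE yx).
Qed.

Lemma outside_ge0 b Y : 0 <= outside b Y.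
Proof. by apply: sumr_ge0 => x _; rewrite mulr_ge0. Qed.

Lemma ie_outside b s : ie (outside b) s = outside b (union_of s).
Proof.
rewrite /outside ie_sum; apply: eq_bigr => x _.
rewrite (ieZ _ (fun E => `[< E x >]%:Z)); congr (_ * _).
have -> : ie (fun E => `[< E x >]%:Z) s = ie (fun E => `[< [set x] `<=` E >]%:Z) s.
  by apply: eq_ie => E; congr (Posz (nat_of_bool _)); apply: asbool_equiv_eq;
    split=> [Ex _ ->//|]; apply.
rewrite ie_subset; congr (Posz (nat_of_bool _)); apply: asbool_equiv_eq.
by split=> -[E Es Ex]; exists E => //; [apply: Ex|move=> _ ->].
Qed.

End Weights.

Section RelativePredimension.
Variables (T : finType) (B : pregeometry T).
Implicit Types (C E F Y Z b : set T) (s : seq (set T)).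
Local Open Scope ring_scope.

Lemma finite_dim_fin Y : finite_dim B Y.
Proof.
have [] // := @sdim_le _ B Y #|T|; move=> A _.
by apply: leq_trans (dim_le_card _ _) _; rewrite -(card_uniqP (fset_uniq A)) max_card.
Qed.
Hint Resolve finite_dim_fin : core.

Lemma sdim_fin Y : sdim B Y = B (fset_set Y).
Proof. by rewrite -sdim_fset fset_setK//; apply: finite_finset. Qed.

Lemma sdimU1 Y x : (sdim B (x |` Y) <= (sdim B Y).+1)%N.
Proof.
rewrite !sdim_fin fset_setU1; last exact: finite_finset.
by case/andP: (dim_step B (fset_set Y) x).
Qed.

Lemma sdim_submod Y Z :
  (sdim B (Y `|` Z) + sdim B (Y `&` Z) <= sdim B Y + sdim B Z)%N.
Proof.
by rewrite !sdim_fin fset_setU ?fset_setI; first exact: dim_submod;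
  apply: finite_finset.
Qed.

(** Every point added to Y raises the dimension by at most one. *)
Lemma sdim_outside b Y Z : Y `<=` Z -> (forall x, Z x -> ~ Y x -> ~ b x) ->
  (sdim B Z)%:Z - (sdim B Y)%:Z <= outside b Z - outside b Y.
Proof.
have := leqnn `|outside b Z - outside b Y|%N.
move: {2}(`|outside b Z - outside b Y|%N) => n; elim: n Y => [|n IH] Y lenY YZ ZYb.
- have [[x Zx nYx]|no] := pselect (exists2 x, Z x & ~ Y x); last first.
    have -> : Y = Z; last by lia.
    by apply/seteqP; split => // x Zx; apply: contrapT => nY; apply: no; exists x.
  have := outside_mono b (Y := x |` Y) (Z := Z).
  have := outsideUI b [set x] Y; rewrite (_ : [set x] `&` Y = set0); last first.
    by apply/seteqP; split => // y [-> ].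
  rewrite outside1 (outside_sub (Y := set0))// asboolF; last exact: ZYb.
  move=> /= e le; have {}le := le _; exfalso.
  have : outside b (x |` Y) <= outside b Z by apply: le => y [->|/YZ].
  by move: (outside_mono b YZ); lia.
- have [[x Zx nYx]|no] := pselect (exists2 x, Z x & ~ Y x); last first.
    have -> : Y = Z; last by lia.
    by apply/seteqP; split => // x Zx; apply: contrapT => nY; apply: no; exists x.
  have xYZ : x |` Y `<=` Z by move=> y [->|/YZ].
  have := outsideUI b [set x] Y; rewrite (_ : [set x] `&` Y = set0); last first.
    by apply/seteqP; split => // y [-> ].
  rewrite outside1 (outside_sub (Y := set0))// asboolF; last exact: ZYb.
  move=> /= e; have := IH (x |` Y); have := sdimU1 Y x.
  have := outside_mono b xYZ; have := outside_mono b YZ => o1 o2 o3 /(_ _ xYZ).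
  move=> IH1; suff : (sdim B Z)%:Z - (sdim B (x |` Y))%:Z <=
     outside b Z - outside b (x |` Y) by lia.
  apply: IH1; first by lia.
  by move=> y Zy nY; apply: ZYb => // Yy; apply: nY; right.
Qed.

(** In a hypergraph presentation of B, [rho Y] is the number of points of Y
    outside b minus the number of relations inside Y that do not lie inside b.
    Only these properties are used to build amalgams. *)
Record relative_predimension (b : set T) (rho : set T -> int) : Prop := {
  rpred_ge0 : forall Y, 0 <= rho Y;
  rpred_flat : forall s, rho (union_of s) <= ie rho s;
  rpred_base : forall Y, Y `<=` b -> rho Y = 0;
  rpred_step : forall x Y, rho (x |` Y) <= rho Y + (~~ `[< b x >])%:Z;
  rpred_dim : forall Y, (sdim B Y)%:Z <= (sdim B (Y `&` b))%:Z + rho Y;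
  rpred_closed : forall Y, is_closed B Y ->
    (sdim B Y)%:Z = (sdim B (Y `&` b))%:Z + rho Y }.

(** For closed Y the number h Y of relations inside Y and not inside b is forced
    by the dimensions, and Moebius inversion over the closed sets distributes it
    into weights mu. Their sum below a family s of closed sets is [ie h s], and
    strength bounds it by the number of points of the union outside b. The weight
    of a closed F is the gap between [h F] and [ie h] of the proper closed subsets
    of F: it is nonnegative by strength if b spans F, and by flatness otherwise,
    as one proper closed subset then contains all of F in b. *)
Lemma exists_relative_predimension b : flat B -> strong B b ->
  exists rho, relative_predimension b rho.
Proof.
move=> /flatP fB /strongP sb; pose K := is_closed B.
have fdcK E : K E -> fdc B E by [].
pose h Y : int := (sdim B (Y `&` b))%:Z + outside b Y - (sdim B Y)%:Z.
have ie_h s : ie h s = alt_in B b s + outside b (union_of s) - alt B s.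
  by rewrite /h ieB ieD ie_outside.
have [mu [mu0 hmu]] := moebius_inversion K h.
have KI : forall E F, K E -> K F -> K (E `&` F) by move=> E F; apply: is_closedI.
have ie_mu := ie_moebius KI hmu.
have alt_in_le s : (forall E, E \in s -> K E) -> alt_in B b s <= alt B s.
  by move=> Ks; apply: sb => E /Ks /fdcK.
have alt_ge s : (forall E, E \in s -> K E) -> (sdim B (union_of s))%:Z <= alt B s.
  by move=> Ks; apply: fB => E /Ks /fdcK.
have mu_ge0 e : 0 <= mu e.
  have [Ke|/mu0 -> //] := pselect (K [set` e]).
  pose F := [set` e]; pose P E := [/\ K E, E `<=` F & E <> F].
  have Ks E : E \in sets_of P -> K E by move=> /sets_ofP[].
  suff [le me] : ie h (sets_of P) <= h F /\ h F = mu e + ie h (sets_of P) by lia.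
  have subF : union_of (sets_of P) `<=` F by move=> x [E /sets_ofP[_ EF _] /EF].
  have outF := outside_mono b subF.
  split; last first.
    rewrite hmu// /mass (bigD1 e)//= asboolT// mulr1; congr (_ + _).
    rewrite ie_mu// [RHS](bigD1 e)//= asboolF ?mulr0 ?add0r; last first.
      by move=> [E /sets_ofP[_ EF nEF] FE]; apply: nEF; apply/seteqP.
    apply: eq_bigr => e' ne; have [Ke'|/mu0 -> //] := pselect (K [set` e']).
    congr (_ * Posz (nat_of_bool _)); apply: asbool_equiv_eq; split => [e'F|].
      exists [set` e'] => //; apply/sets_ofP; split => // e'e.
      by case/negP: ne; apply/eqP/setP => x; have := congr1 (@^~ x) e'e => /= /propeqP[];
        move=> h1 h2; apply/idP/idP.
    by move=> [E /sets_ofP[_ EF _] e'E]; apply: subset_trans EF.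
  have [eqF|ltF] := eqVneq (sdim B (F `&` b)) (sdim B F).
    by have := alt_in_le _ Ks; rewrite ie_h /h eqF; lia.
  pose C := hull B (F `&` b); have [[cC _] FbC dC] := hullP (finite_dim_fin (F `&` b)).
  have CF : C `<=` F by apply: hull_sub => // x [].
  have Cs : C \in sets_of P.
    by apply/sets_ofP; split => // CF'; case/eqP: ltF; rewrite -dC -/C CF'.
  have -> : ie h (sets_of P) = (sdim B (F `&` b))%:Z +
      outside b (union_of (sets_of P)) - alt B (sets_of P).
    rewrite ie_h; congr (_ + _ - _); transitivity
      (ie (fun E => (sdim B ((F `&` b) `&` E))%:Z) (sets_of P)).
      apply: (@ie_ext _ (fun E => E `<=` F)).
      - by move=> E E' EF _ x [/EF].
      - move=> E EF; congr (sdim B _)%:Z; apply/seteqP.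
        by split => x; [move=> [Ex bx]; split => //; split => //; apply: EF|case=> -[]].
      - by move=> E /sets_ofP[].
    by rewrite (ie_absorb (fun D => (sdim B D)%:Z))//; exists C.
  have := alt_ge _ Ks; have := @sdim_outside b _ _ subF; rewrite /h => h1 h2.
  suff : (sdim B F)%:Z - (sdim B (union_of (sets_of P)))%:Z <=
    outside b F - outside b (union_of (sets_of P)) by lia.
  by apply: h1 => x Fx nU bx; apply: nU; exists C => //; apply: FbC.
pose rho Y := outside b Y - mass mu Y.
pose inside Y := sets_of (fun E => K E /\ E `<=` Y).
have insideK Y E : E \in inside Y -> K E by move=> /sets_ofP[].
have insideS Y : union_of (inside Y) `<=` Y by move=> x [E /sets_ofP[_ EY] /EY].
have mass_inside Y : mass mu Y = ie h (inside Y).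
  rewrite ie_mu; last exact: insideK.
  apply: eq_bigr => e _; have [Ke|/mu0 -> //] := pselect (K [set` e]).
  congr (_ * Posz (nat_of_bool _)); apply: asbool_equiv_eq; split => [eY|].
    by exists [set` e] => //; apply/sets_ofP.
  by move=> [E /sets_ofP[_ EY] eE]; apply: subset_trans EY.
have mass_ge0 Y : 0 <= mass mu Y by apply: sumr_ge0 => e _; rewrite mulr_ge0.
have massS Y Z : Y `<=` Z -> mass mu Y <= mass mu Z.
  move=> YZ; apply: ler_sum => e _; apply: ler_wpM2l => //; rewrite lez_nat.
  by case: asboolP => // eY; rewrite asboolT//; apply: subset_trans YZ.
have rho_ge0 Y : 0 <= rho Y.
  rewrite /rho mass_inside ie_h; have := alt_in_le _ (insideK Y).
  by have := outside_mono b (insideS Y); lia.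
exists rho; split => //.
- move=> s; rewrite /rho ieB ie_outside lerD2l lerN2 ie_mass.
  apply: ler_sum => e _; apply: ler_wpM2l => //; rewrite lez_nat.
  case: asboolP => // -[E Es eE]; rewrite asboolT// => x /eE Ex; by exists E.
- move=> Y Yb; apply/eqP; rewrite eq_le rho_ge0 andbT /rho outside_sub//.
  by rewrite sub0r oppr_le0.
- move=> x Y; have := outsideUI b [set x] Y; rewrite outside1.
  have := massS Y (x |` Y) (@subsetUr _ _ _); have := outside_ge0 b ([set x] `&` Y).
  by rewrite /rho; lia.
- (* Relations inside Y are counted separately inside and outside the closure C
     of the part of Y in b: strength bounds the former, flatness the latter. *)
  move=> Y; pose C := hull B (Y `&` b); pose s := inside Y.
  have [[cC _] YbC dC] := hullP (finite_dim_fin (Y `&` b)).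
  pose t := [seq C `&` E | E <- s].
  have Kt E : E \in t -> K E.
    by move=> /mapP[F Fs ->]; apply: KI => //; apply: insideK Fs.
  have KCs E : E \in C :: s -> K E.
    by rewrite inE => /orP[/eqP -> //|]; apply: insideK.
  have e1 : mass mu Y = ie h (C :: s) - h C + ie h t.
    by rewrite mass_inside -/s /= /t ie_setI; lia.
  have e2 : ie h t <= outside b (Y `&` C).
    rewrite ie_h; have := alt_in_le _ Kt.
    have : outside b (union_of t) <= outside b (Y `&` C); last by lia.
    apply: outside_mono => x [_ /mapP[F Fs ->] [Cx Fx]]; split => //.
    by apply: insideS; exists F; first exact: Fs.
  have e3 : alt_in B b (C :: s) = (sdim B (C `&` b))%:Z.
    rewrite /alt_in /= (_ : ie (fun F => (sdim B ((C `&` F) `&` b))%:Z) s =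
      ie (fun F => (sdim B (F `&` b))%:Z) s); first by rewrite addrK.
    apply: (@ie_ext _ (fun E => E `<=` Y)).
    + by move=> E E' EF _ x [/EF].
    + move=> E EY; congr (sdim B _)%:Z; apply/seteqP; split => x; first by case=> -[].
      by move=> [Ex bx]; split => //; split => //; apply: YbC; split => //; apply: EY.
    + by move=> E /sets_ofP[].
  have e4 := alt_ge _ KCs; have e5 := ie_h (C :: s).
  set U := union_of (C :: s) in e4 e5.
  have UYC : U `<=` Y `|` C.
    by rewrite /U union_of_cons => x [|/insideS]; by [right|left].
  have CU : C `<=` U by rewrite /U union_of_cons => x; left.
  have e6 : (sdim B (Y `|` C))%:Z - (sdim B U)%:Z <= outside b (Y `|` C) - outside b U.
    apply: sdim_outside => // x [Yx|Cx] nU bx; apply: nU; apply: CU => //.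
    by apply: YbC.
  have e7 := outsideUI b Y C.
  have e8 : (sdim B Y <= sdim B (Y `|` C))%N by apply: sdimS.
  have hC : h C = (sdim B (C `&` b))%:Z + outside b C - (sdim B C)%:Z by [].
  by rewrite -/C in dC; rewrite /rho; lia.
- by move=> Y KY; have := hmu _ KY; rewrite /rho /h; lia.
Qed.

End RelativePredimension.

(** * Free amalgams *)

Section Predimension.
Variables (D : finType) (g : set D -> int).
Implicit Types (Y Z : set D) (A : {fset D}).
Local Open Scope ring_scope.
Hypothesis g_ge0 : forall Y, 0 <= g Y.
Hypothesis g0 : g set0 = 0.
Hypothesis g_step : forall x Y, g (x |` Y) <= g Y + 1.
Hypothesis g_submod : forall Y Z, g (Y `|` Z) + g (Y `&` Z) <= g Y + g Z.

Lemma pregeometry_of_predimension : exists P : pregeometry D, forall Y,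
  (sdim P Y)%:Z <= g Y /\ exists2 Z, Y `<=` Z & (sdim P Y)%:Z = g Z.
Proof.
pose attained A n := exists2 Z, [set` A] `<=` Z & g Z = n%:Z.
have /choice[d dP] : forall A, exists n,
    attained A n /\ forall Z, [set` A] `<=` Z -> n%:Z <= g Z.
  move=> A; have ex : exists n, `[< attained A n >].
    exists `|g [set` A]|%N; apply/asboolP; exists [set` A] => //.
    by rewrite gez0_abs.
  case: (ex_minnP ex) => n /asboolP an min; exists n; split => // Z AZ.
  rewrite -(gez0_abs (g_ge0 Z)) lez_nat; apply: min; apply/asboolP; exists Z => //.
  by rewrite gez0_abs.
have d0 : d fset0 = 0%N.
  have [_ /(_ set0)] := dP fset0; rewrite g0 => /(_ _); case: (d fset0) => // n.
  by move=> h; have := h (fun x => elimF idP (in_fset0 x)).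
have dstep A x : (d A <= d (x |` A)%fset <= (d A).+1)%N.
  have [[Z AZ gZ] dA] := dP A; have [[Z' AZ' gZ'] dxA] := dP (x |` A)%fset.
  apply/andP; split.
    rewrite -lez_nat -gZ'; apply: dA => y /= yA; apply: AZ'.
    by rewrite /= !inE yA orbT.
  rewrite -lez_nat; apply: (@le_trans _ _ (g (x |` Z))).
    apply: dxA => y /=; rewrite !inE => /orP[/eqP ->|/AZ]; by [left|right].
  by apply: le_trans (g_step x Z) _; rewrite gZ -addn1 PoszD.
have dsub A A' : (d (A `|` A')%fset + d (A `&` A')%fset <= d A + d A')%N.
  have [[Z AZ gZ] _] := dP A; have [[Z' AZ' gZ'] _] := dP A'.
  have [_ /(_ (Z `|` Z')) dU] := dP (A `|` A')%fset.
  have [_ /(_ (Z `&` Z')) dI] := dP (A `&` A')%fset.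
  rewrite -lez_nat !PoszD -gZ -gZ'; apply: le_trans (g_submod Z Z').
  apply: lerD; [apply: dU|apply: dI] => x /=; rewrite !inE.
    by move=> /orP[/AZ|/AZ']; [left|right].
  by move=> /andP[/AZ ? /AZ' ?].
exists (Pregeometry d0 dstep dsub) => Y; rewrite sdim_fin /=.
have [[Z YZ gZ] dY] := dP (fset_set Y).
by rewrite fset_setK in YZ dY; try exact: finite_finset; split; [apply: dY|exists Z].
Qed.

End Predimension.

Lemma pushout (S A B : finType) (c : S -> A) (i : S -> B) :
  injective c -> injective i ->
  exists (D : finType) (a : A -> D) (b : B -> D), [/\ injective a, injective b,
    forall s, a (c s) = b (i s),
    forall x y, a x = b y -> exists2 s, x = c s & y = i s &
    forall z, (exists x, z = a x) \/ (exists y, z = b y)].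
Proof.
move=> c_inj i_inj; pose D := (A + {y : B | y \notin codom i})%type.
have /choice[b bP] : forall y, exists z : D, (exists2 s, y = i s & z = inl (c s)) \/
    exists h : y \notin codom i, z = inr (exist _ y h).
  move=> y; have [/codomP[s ->]|/negP h] := pselect (y \in codom i).
    by exists (inl (c s)); left; exists s.
  by exists (inr (exist _ y h)); right; exists h.
have bi s : b (i s) = inl (c s).
  by have [[s' /i_inj -> //]|[h]] := bP (i s); case/negP: (h); apply: codom_f.
exists D, inl, b; split => //.
- by move=> x y [].
- move=> y y' e; have [[s ys bs]|[h bh]] := bP y; have [[s' ys' bs']|[h' bh']] := bP y';
    move: e; rewrite ?bs ?bh ?bs' ?bh' => // -[].
    by move=> /c_inj ss; rewrite ys ys' ss.
  by [].
- move=> x y e; have [[s ys bs]|[h bh]] := bP y; last by rewrite bh in e.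
  by exists s => //; rewrite bs in e; case: e.
- case=> [x|[y h]]; first by left; exists x.
  right; exists y; have [[s ys _]|[h' ->]] := bP y; last by rewrite (bool_irrelevance h h').
  by case/negP: (h); rewrite ys codom_f.
Qed.

Section FreeAmalgam.
Variables (S A B : finType).
Variables (PS : pregeometry S) (PA : pregeometry A) (PB : pregeometry B).
Variables (c : S -> A) (i : S -> B).
Hypotheses (c_emb : embedding PS PA c) (i_emb : embedding PS PB i).
Hypotheses (A_flat : flat PA) (B_flat : flat PB) (i_strong : strong PB (range i)).
Local Open Scope ring_scope.

(** The predimension of Y in the pushout is the dimension of its part in A plus
    the relative predimension of its part in B over the base, that is, the
    relations of B outside the base are added freely to A. The base need not be
    strong in A: A and B still embed, and the alternating sums in the amalgam are
    those of A and B minus those of the base, so that failures of strength of B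
    come from failures of strength of the base in A. *)
Lemma free_amalgam : exists (D : finType) (P : pregeometry D) (a : A -> D) (b : B -> D),
  [/\ embedding PA P a, embedding PB P b & forall s, a (c s) = b (i s)] /\
  [/\ flat P, strong P (range a) &
    forall t, all_fdc P t -> alt P t = alt PA (map (preimage a) t) +
      (alt PB (map (preimage b) t) - alt PS (map (preimage (a \o c)) t))].
Proof.
have [D [a [b [a_inj b_inj abs ab_eq abT]]]] := pushout (proj1 c_emb) (proj1 i_emb).
have [rho rhoP] := exists_relative_predimension B_flat i_strong.
pose g (Y : set D) : int := (sdim PA (a @^-1` Y))%:Z + rho (b @^-1` Y).
have g_ge0 Y : 0 <= g Y by rewrite addr_ge0// (rpred_ge0 rhoP).
have g0 : g set0 = 0.
  rewrite /g !preimage_set0 (rpred_base rhoP)// addr0.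
  by rewrite sdim_fin fset_set0 dim0.
have preU (X : finType) (f : X -> D) (f_inj : injective f) x Y :
    f @^-1` (f x |` Y) = x |` f @^-1` Y.
  apply/seteqP; split => y [|Yy]; [move=> /f_inj ->|right|move=> ->|right] => //;
  by left.
have preN (X : finType) (f : X -> D) z Y : (forall x, f x <> z) ->
    f @^-1` (z |` Y) = f @^-1` Y.
  by move=> nz; apply/seteqP; split => y; [case=> // /nz|right].
have g_step z Y : g (z |` Y) <= g Y + 1.
  have [[y ->]|nb] := pselect (exists y, z = b y).
    have [[s ->]|ni] := pselect (exists s, y = i s).
      rewrite /g -{1}abs !preU// addrAC; apply: lerD.
        by have := sdimU1 PA (a @^-1` Y) (c s); lia.
      apply: le_trans (rpred_step rhoP _ _) _; rewrite asboolT ?addr0//.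
    rewrite /g preN; last by move=> x /ab_eq[s _ ys]; apply: ni; exists s.
    rewrite preU// -addrA; apply: lerD => //.
    apply: le_trans (rpred_step rhoP _ _) _; rewrite asboolF// => -[s _ ys].
    by apply: ni; exists s.
  have [[x xz]|[y yz]] := abT z; last by case: nb; exists y.
  rewrite xz /g preU// [X in rho X]preN; last first.
    by move=> y e; apply: nb; exists y; rewrite xz.
  by have := sdimU1 PA (a @^-1` Y) x; lia.
have g_submod Y Z : g (Y `|` Z) + g (Y `&` Z) <= g Y + g Z.
  have h1 := sdim_submod PA (a @^-1` Y) (a @^-1` Z).
  have h2 : rho (b @^-1` Y `|` b @^-1` Z) + rho (b @^-1` Y `&` b @^-1` Z) <=
      rho (b @^-1` Y) + rho (b @^-1` Z).
    have := rpred_flat rhoP [:: b @^-1` Y; b @^-1` Z].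
    by rewrite /= !union_of_cons union_of_nil setU0 !(subr0, addr0) lerBrDr.
  by rewrite /g !preimage_setU !preimage_setI; lia.
have [P PP] := pregeometry_of_predimension g_ge0 g0 g_step g_submod.
have P_le Y : (sdim P Y)%:Z <= g Y by have [] := PP Y.
have P_ex Y : exists2 Z, Y `<=` Z & (sdim P Y)%:Z = g Z by have [] := PP Y.
have base F : (a \o c) @^-1` F = i @^-1` (b @^-1` F).
  by apply/seteqP; split => s /=; rewrite abs.
have rho_dim Y : (sdim PB (b @^-1` Y))%:Z <=
    (sdim PS ((a \o c) @^-1` Y))%:Z + rho (b @^-1` Y).
  by rewrite base (sdim_preimage i_emb); apply: (rpred_dim rhoP).
have S_le_A Y : (sdim PS ((a \o c) @^-1` Y) <= sdim PA (a @^-1` Y))%N.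
  rewrite (_ : _ @^-1` Y = c @^-1` (a @^-1` Y))// (sdim_preimage c_emb).
  by apply: sdimS; [apply: subIsetl|apply: finite_dim_fin].
have emb (X : finType) (PX : pregeometry X) (f : X -> D) : injective f ->
    (forall A0 : {fset X}, (sdim P [set` [fset f x | x in A0]%fset])%:Z =
       (sdim PX [set` A0])%:Z) -> embedding PX P f.
  by move=> f_inj fd; split => // A0; have := fd A0; rewrite !sdim_fset => -[].
have imE (X : finType) (f : X -> D) (A0 : {fset X}) :
    [set` [fset f x | x in A0]%fset] = f @` [set` A0].
  apply/seteqP; split => [_ /imfsetP[x xA ->]|_ [x xA <-]]; first by exists x.
  by apply/imfsetP; exists x.
have preK (X X' : finType) (f : X -> X') (f_inj : injective f) Y : f @^-1` (f @` Y) = Y.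
  by apply/seteqP; split => x; [move=> [y Yy /f_inj <-]|exists x].
have a_emb : embedding PA P a.
  apply: emb => // A0; rewrite imE; apply/eqP; rewrite eq_le; apply/andP; split.
    apply: le_trans (P_le _) _; rewrite /g preK// (rpred_base rhoP) ?addr0//.
    by move=> y [x _ /ab_eq[s _ ->]]; exists s.
  have [Z AZ ->] := P_ex (a @` [set` A0]); apply: le_trans (_ : (sdim PA (a @^-1` Z))%:Z <= _).
    rewrite lez_nat; apply: sdimS (finite_dim_fin _ _) => x xA.
    by apply: AZ; exists x.
  by rewrite /g lerDl (rpred_ge0 rhoP).
have b_emb : embedding PB P b.
  apply: emb => // A0; rewrite imE; apply/eqP; rewrite eq_le; apply/andP; split.
    (* The bound is attained at the image of a closed set, for which
       [rpred_closed] is an equality. *)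
    have [[cC _] AC dC] := hullP (finite_dim_fin PB [set` A0]).
    set C := hull PB [set` A0] in cC AC dC.
    apply: (@le_trans _ _ (g (b @` C))).
      apply: le_trans (P_le _); rewrite lez_nat; apply: sdimS (finite_dim_fin _ _).
      exact: image_subset.
    have -> : (sdim PB [set` A0])%:Z =
        (sdim PB (C `&` range i))%:Z + rho C by rewrite -dC (rpred_closed rhoP cC).
    rewrite /g preK// lerD2r lez_nat -(sdim_preimage i_emb).
    rewrite (_ : a @^-1` (b @` C) = c @` (i @^-1` C)); last first.
      apply/seteqP; split => [x [y Cy /esym/ab_eq[s -> ys]]|_ [s Cs <-]].
        by exists s => //; rewrite /= -ys.
      by exists (i s) => //; rewrite abs.
    rewrite -{2}(preK _ _ c (proj1 c_emb) (i @^-1` C)).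
    by rewrite (sdim_preimage c_emb) (setIidl _)//; apply: image_subset.
  have [Z AZ ->] := P_ex (b @` [set` A0]).
  apply: (@le_trans _ _ (sdim PB (b @^-1` Z))%:Z).
    rewrite lez_nat; apply: sdimS (finite_dim_fin _ _) => x xA.
    by apply: AZ; exists x.
  by apply: le_trans (rho_dim Z) _; rewrite lerD2r lez_nat.
have P_closed F : fdc P F -> (sdim P F)%:Z = g F.
  move=> [cF _]; have [Z FZ e] := P_ex F; rewrite e; congr g.
  apply/seteqP; split => //; apply: closed_sub (finite_dim_fin _ _) cF _.
  by rewrite (setIidl FZ) -lez_nat e.
have alt_P t : all_fdc P t ->
    alt P t = alt PA (map (preimage a) t) + ie rho (map (preimage b) t).
  move=> ct; rewrite /alt !ie_map -?ieD//.
  by apply: (@ie_ext _ (fdc P)) => //; apply: fdcI.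
exists D, P, a, b; split => //; split.
- apply/flatP => t ct; rewrite alt_P//; apply: le_trans (P_le _) _.
  have U (X : finType) (f : X -> D) :
      f @^-1` union_of t = union_of (map (preimage f) t).
    apply/seteqP; split => [x [F Ft Fx]|x [_ /mapP[F Ft ->] Fx]]; last by exists F.
    by exists (f @^-1` F) => //; apply: map_f.
  rewrite /g !U; apply: lerD; last exact: (rpred_flat rhoP).
  apply: (flatP _).1 => // _ /mapP[F Ft ->]; exact: (fdc_preimage a_emb (ct _ Ft)).
- apply/strongP => t ct; rewrite alt_P// -(alt_preimage a_emb) lerDl.
  by apply: le_trans (rpred_ge0 rhoP _) (rpred_flat rhoP _).
- move=> t ct; rewrite alt_P//; congr (_ + _).
  rewrite /alt !ie_map // -ieB; apply: (@ie_ext _ (fdc P)) => //; first exact: fdcI.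
  move=> F cF /=; rewrite base (sdim_preimage i_emb).
  have [cbF _] := fdc_preimage b_emb cF.
  by rewrite (rpred_closed rhoP cbF) addrAC subrr add0r.
Qed.

End FreeAmalgam.

(** * Extension properties of the generic pregeometry *)

Section Pullback.
Variables (T M : choiceType) (G : pregeometry M) (f : T -> M).
Hypothesis f_inj : injective f.

Lemma pullback_pregeometry : exists B : pregeometry T, embedding B G f.
Proof.
pose d (A : {fset T}) := G [fset f x | x in A]%fset.
have d0 : d fset0 = 0 by rewrite /d imfset0 dim0.
have dstep A x : d A <= d (x |` A)%fset <= (d A).+1.
  by rewrite /d imfsetU1; apply: dim_step.
have dsub A B : d (A `|` B)%fset + d (A `&` B)%fset <= d A + d B.
  by rewrite /d imfsetU imfsetI; [apply: dim_submod|move=> x y _ _ /f_inj].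
by exists (Pregeometry d0 dstep dsub).
Qed.

End Pullback.

Section EmbeddingComposition.
Variables (L M N : choiceType) (F : pregeometry L) (G : pregeometry M) (K : pregeometry N).
Variables (g : L -> M) (f : M -> N).

Lemma imfset_compose (A : {fset L}) :
  [fset f y | y in [fset g x | x in A]]%fset = [fset (f \o g) x | x in A]%fset.
Proof.
apply/fsetP => z; apply/imfsetP/imfsetP => [[_ /imfsetP[x xA ->] ->]|[x xA ->]].
  by exists x.
by exists (g x) => //; apply/imfsetP; exists x.
Qed.

Lemma embedding_comp : embedding F G g -> embedding G K f -> embedding F K (f \o g).
Proof.
move=> [g_inj gd] [f_inj fd]; split; first exact: inj_comp.
by move=> A; rewrite -imfset_compose fd gd.
Qed.

Lemma embedding_factor : embedding G K f -> embedding F K (f \o g) -> embedding F G g.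
Proof.
move=> [f_inj fd] [fg_inj fgd]; split; first exact: inj_compr fg_inj.
by move=> A; rewrite -fd imfset_compose fgd.
Qed.

End EmbeddingComposition.

Lemma strongT (M : choiceType) (G : pregeometry M) : strong G setT.
Proof.
apply/strongP => s _; rewrite le_eqVlt; apply/orP; left; apply/eqP.
by apply: eq_ie => E; rewrite setIT.
Qed.

Lemma flat_isomorphic (M N : choiceType) (G : pregeometry M) (K : pregeometry N) :
  isomorphic G K -> flat G -> flat K.
Proof.
move=> [f [f' fK f'K] f_emb] fG; have f'_emb : embedding K G f'.
  apply: (embedding_factor f_emb); split; first by move=> x y /=; rewrite !f'K.
  move=> A; congr (K _); apply/fsetP => x.
  apply/imfsetP/idP => [[y yA ->]|xA]; first by rewrite /= f'K.
  by exists x => //=; rewrite f'K.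
apply: (flat_embedding f'_emb fG); rewrite (_ : range f' = setT); first exact: strongT.
by apply/seteqP; split => // x _; exists (f x).
Qed.

Section FiniteStrongSubsets.
Variables (M : choiceType) (G : pregeometry M).

Lemma finite_strong_model (A : set M) : flat G -> finite_set A -> strong G A ->
  exists (T : finType) (B : pregeometry T) (v : T -> M),
    [/\ embedding B G v, range v = A & flat B].
Proof.
move=> fG finA sA; pose T : finType := fset_set A; pose v (x : T) : M := val x.
have [B vE] := @pullback_pregeometry T M G v val_inj.
have rv : range v = A.
  apply/seteqP; split => [_ [x _ <-]|x Ax].
    by have := valP x; rewrite in_fset_set// inE.
  have xA : x \in fset_set A by rewrite in_fset_set// inE.
  by exists [` xA]%fset.
exists T, B, v; split => //; apply: (flat_embedding vE) => //.
by rewrite rv.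
Qed.

Lemma factor_through (S T : Type) (v : T -> M) (c : S -> M) :
  (forall s, range v (c s)) -> exists u : S -> T, v \o u = c.
Proof.
move=> H; have /choice[u uP] : forall s, exists t, v t = c s.
  by move=> s; have [t _ e] := H s; exists t.
by exists u; apply/funext.
Qed.

End FiniteStrongSubsets.

Section Generic.
Variables (M : countType) (G : pregeometry M).
Hypothesis hG : is_generic G.
Local Open Scope ring_scope.

(** A finite strong set containing bases of all intersections and of the union
    of a family has the same relevant dimensions as G, and it is flat. *)
Lemma generic_flat : flat G.
Proof.
apply/flatP => s cs; have [Z [_ ZP]] := finite_spanning_set cs.
have fU : finite_dim G (union_of s) by apply: finite_dim_union => E /cs[].
have [W [WU _ GW]] := sdim_max fU.
have [A [ZWA finA sA]] := generic_cover hG (finite_fset (Z `|` W)%fset).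
have ZA : [set` Z] `<=` A by move=> x xZ; apply: ZWA; rewrite /= inE [x \in Z]xZ.
have WA : [set` W] `<=` A by move=> x xW; apply: ZWA; rewrite /= inE [x \in W]xW orbT.
have [T [B [fB iB]]] := generic_age hG finA sA.
have fA := flat_isomorphic iB fB; have vE := embedding_val G A.
have := (flatP _).1 fA (map (preimage set_val) s).
rewrite (alt_preimage vE) range_set_val (proj1 (ZP A ZA)) => H.
apply: le_trans (H _); last by move=> _ /mapP[E Es ->]; apply: (fdc_preimage vE (cs _ Es)).
have -> : union_of (map (preimage (set_val : A -> M)) s) = set_val @^-1` union_of s.
  apply/seteqP; split => [x [_ /mapP[F Ft ->] Fx]|x [F Ft Fx]]; first by exists F.
  by exists (set_val @^-1` F) => //; apply: map_f.
rewrite (sdim_preimage vE) range_set_val -GW lez_nat; apply: le_sdim.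
  exact: finite_dimS (@subIsetl _ _ A) fU.
by move=> x xW; split; [apply: WU|apply: WA].
Qed.

Lemma generic_finite_strong (X : set M) : finite_set X ->
  exists (T : finType) (B : pregeometry T) (v : T -> M),
    [/\ embedding B G v, X `<=` range v, strong G (range v) & flat B].
Proof.
move=> finX; have [A [XA finA sA]] := generic_cover hG finX.
have [T [B [v [vE rv fB]]]] := finite_strong_model generic_flat finA sA.
by exists T, B, v; rewrite rv.
Qed.

(** The extension property, with the strong subset replaced by an embedding of
    a finite type. *)
Lemma generic_strong_extension (T T' : finType) (B : pregeometry T)
    (B' : pregeometry T') (g : T -> T') (c : T -> M) :
  embedding B G c -> strong G (range c) -> flat B' -> embedding B B' g ->
  strong B' (range g) -> exists c' : T' -> M,
  [/\ embedding B' G c', c' \o g = c & strong G (range c')].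
Proof.
move=> cE sc fB' gE sg; have finc : finite_set (range c) by apply: finite_image.
have [j jP] := @factor_through _ _ _ c (set_val : range c -> M) (fun x => set_valP x).
have jE : embedding (subpregeometry G (range c)) B j.
  by apply: (embedding_factor cE); rewrite jP; apply: embedding_val.
have jT : range (g \o j) = range g.
  apply/seteqP; split => [_ [x _ <-]|_ [t _ <-]]; first by exists (j x).
  have [y ye] : exists y : range c, set_val y = c t.
    by exists (exist _ (c t) (mem_set (imageT c t))).
  exists y => //=; congr g; apply: (proj1 cE).
  by rewrite -[LHS]/((c \o j) y) jP.
have [|f [fE fP sf]] := generic_extension hG finc sc fB' (embedding_comp jE gE).
  by rewrite jT.
exists f; split => //; apply/funext => t /=.
have [y ye] : exists y : range c, set_val y = c t.
  by exists (exist _ (c t) (mem_set (imageT c t))).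
rewrite -ye -fP /=; congr (f (g _)); apply: (proj1 cE).
by rewrite -ye -[RHS]/((c \o j) y) jP.
Qed.

(** The extension property for copies that are not strong, in a form that passes
    to ultrapowers: if s is a failure of strength for c', then [map phi s] is one
    for c, with as many sets and no larger dimensions. Let A be a finite strong set
    containing the range of c, amalgamate A with T' freely over T, and embed the
    amalgam over A. *)
Lemma generic_extension_transfer (T T' : finType) (B : pregeometry T)
    (B' : pregeometry T') (g : T -> T') (c : T -> M) :
  embedding B G c -> flat B' -> embedding B B' g -> strong B' (range g) ->
  exists (c' : T' -> M) (phi : set M -> set M),
  [/\ embedding B' G c', c' \o g = c,
    forall E, fdc G E -> fdc G (phi E) /\ (sdim G (phi E) <= sdim G E)%N &
    forall s, all_fdc G s ->
      alt G (map phi s) - alt B (map (preimage c) (map phi s)) <=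
      alt G s - alt B' (map (preimage c') s)].
Proof.
move=> cE fB' gE sg.
have finc : finite_set (range c) by apply: finite_image.
have [A [PA [v [vE cv sv fA]]]] := generic_finite_strong finc.
have [c0 c0P] := @factor_through _ _ _ v c (fun x => cv _ (imageT c x)).
have c0E : embedding B PA c0 by apply: (embedding_factor vE); rewrite c0P.
have [D [P [a [b [[aE bE ab] [fP sa altP]]]]]] := free_amalgam c0E gE fA fB' sg.
have [f [fE fa sf]] := generic_strong_extension vE sv fP aE sa.
exists (f \o b), (fun E => hull G (E `&` range v)); split.
- exact: embedding_comp bE fE.
- by apply/funext => s /=; rewrite -ab -[f _]/((f \o a) _) fa -c0P.
- move=> E cE'; have [h1 _ h3 _] := hullsP (range v) cE'; split => //.
  rewrite h3; apply: sdimS; first exact: subIsetl.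
  by case: cE'.
- move=> s cs; have ct : all_fdc P (map (preimage f) s).
    by move=> _ /mapP[E Es ->]; apply: (fdc_preimage fE (cs _ Es)).
  have le1 : alt P (map (preimage f) s) <= alt G s.
    by rewrite (alt_preimage fE); apply: (strongP _ _).1.
  have eA : alt PA (map (preimage a) (map (preimage f) s)) =
      alt G (hulls G (range v) s).
    rewrite alt_hulls_strong// -(alt_preimage vE) -fa -map_comp.
    by congr (alt _ _); apply: eq_map.
  have eB : map (preimage b) (map (preimage f) s) = map (preimage (f \o b)) s.
    by rewrite -map_comp; apply: eq_map.
  have eS : map (preimage (a \o c0)) (map (preimage f) s) =
      map (preimage c) (hulls G (range v) s).
    rewrite -!map_comp; apply/eq_in_map => E Es /=.
    have [_ h _ _] := hullsP (range v) (cs _ Es).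
    apply/seteqP; split => x /=; rewrite -[f _]/((f \o a) (c0 x)) fa;
      rewrite -[v _]/((v \o c0) x) c0P => Ex.
      by have [] : (hull G (E `&` range v) `&` range v) (c x) by rewrite h; split => //; apply: cv.
    by have [] : (E `&` range v) (c x) by rewrite -h; split => //; apply: cv.
  by rewrite -/(hulls G (range v) s) -eS -eA -eB; have := altP _ ct; lia.
Qed.

End Generic.

(** * Ultrapowers of a pregeometry *)

Section UltrafilterFacts.
Variables (I : Type) (U : set_system I).
Context {UU : UltraFilter U}.

Lemma ultra_ex (P : set I) : U P -> exists q, P q.
Proof. by move=> /filter_ex. Qed.

Lemma ultra_not (P : set I) : ~ U P -> U (~` P).
Proof. by move=> nP; have [] := in_ultra_setVsetC P UU. Qed.

Lemma filter_forall_seq (J : eqType) (s : seq J) (P : J -> set I) :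
  (forall j, j \in s -> U (P j)) -> U [set q | forall j, j \in s -> P j q].
Proof.
elim: s => [|a s IH] Ps; first by apply: filterS filterT.
apply: filterS2 (Ps a (mem_head _ _)) (IH (fun j js => Ps j (mem_behead (s := a :: s) js))).
by move=> q Pa Psq j; rewrite inE => /orP[/eqP ->|/Psq].
Qed.

Lemma filter_forall_fin (J : finType) (P : J -> set I) :
  (forall j, U (P j)) -> U [set q | forall j, P j q].
Proof.
move=> UP; apply: filterS (filter_forall_seq (s := enum J) (fun j _ => UP j)).
by move=> q H j; apply: H; rewrite mem_enum.
Qed.

Lemma ultra_bounded (h : I -> nat) n : U [set q | h q <= n] ->
  exists v, U [set q | h q = v].
Proof.
elim: n => [|n IH] Uh.
  by exists 0; apply: filterS Uh => q /=; rewrite leqn0 => /eqP.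
have [Un|/ultra_not nUn] := pselect (U [set q | h q = n.+1]); first by exists n.+1.
apply: IH; apply: filterS2 Uh nUn => q /=; rewrite leq_eqVlt => /orP[/eqP -> //|].
by rewrite ltnS.
Qed.

(** The carrier of the ultrapower consists of canonical representatives of the
    functions modulo U; only separation and surjectivity of the coordinates are
    used afterwards. *)
Lemma exists_ultrapower (M : choiceType) : exists (N : choiceType) (ev : N -> I -> M),
  (forall x y, U [set q | ev x q = ev y q] -> x = y) /\
  (forall f, exists x, U [set q | ev x q = f q]).
Proof.
pose eqU (f : I -> M) : set (I -> M) := [set g | U [set q | g q = f q]].
have eqUf f : eqU f f by apply: filterS filterT.
pose rep f := xget f (eqU f).
have repU f : U [set q | rep f q = f q].
  by rewrite /rep; case: xgetP => [g _ //|/(_ f)]; case; apply: eqUf.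
have rep_eq f g : U [set q | f q = g q] -> rep f = rep g.
  move=> fg; rewrite /rep; have -> : eqU f = eqU g.
    apply/seteqP; split => h hf; apply: filterS2 hf fg => q /= -> //.
  rewrite /xget; case: pselect => // -[]; exists g; apply/asboolP; exact: eqUf.
pose H : set (I -> M) := range rep.
exists H, (fun x q => val x q); split.
  move=> x y xy; have [f _ fx] : range rep (val x) by apply: set_valP.
  have [g _ gy] : range rep (val y) by apply: set_valP.
  apply/val_inj => /=; rewrite -fx -gy; apply: rep_eq.
  apply: filterS3 xy (repU f) (repU g) => q /=.
  by rewrite -fx -gy => -> -> ->.
move=> f; exists (exist _ (rep f) (mem_set (imageT rep f))) => /=.
exact: repU.
Qed.

End UltrafilterFacts.

Section Ultrapower.
Variables (I : Type) (U : set_system I).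
Context {UU : UltraFilter U}.
Variables (M N : choiceType) (G : pregeometry M) (ev : N -> I -> M).
Hypothesis ev_sep : forall x y, U [set q | ev x q = ev y q] -> x = y.
Hypothesis ev_surj : forall f, exists x, U [set q | ev x q = f q].
Implicit Types (C : I -> set M).
Local Open Scope ring_scope.

Definition at_coord (A : {fset N}) q : {fset M} := [fset ev x q | x in A]%fset.

Lemma at_coord_sub A (Y : set M) q :
  [set` at_coord A q] `<=` Y <-> forall x, x \in A -> Y (ev x q).
Proof.
split=> [AY x xA|AY _ /imfsetP[x xA ->]]; last exact: AY.
by apply: AY; apply/imfsetP; exists x.
Qed.

(** The dimension of a finite set is bounded by its cardinality, so its values at
    the coordinates have a limit along U. *)
Lemma ultrapower_pregeometry : exists K : pregeometry N,
  forall A, U [set q | G (at_coord A q) = K A].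
Proof.
have /choice[d dP] : forall A, exists v, U [set q | G (at_coord A q) = v].
  move=> A; apply: (@ultra_bounded _ U UU _ #|` A|); apply: filterS filterT => q _ /=.
  by apply: leq_trans (dim_le_card _ _) _; apply: leq_imfset_card.
have d0 : d fset0 = 0%N.
  by have [q /= <-] := ultra_ex (dP fset0); rewrite /at_coord imfset0 dim0.
have dstep A x : (d A <= d (x |` A)%fset <= (d A).+1)%N.
  have [q /= [<- <-]] := ultra_ex (filterI (dP A) (dP (x |` A)%fset)).
  by rewrite /at_coord imfsetU1; apply: dim_step.
have dsub A B : (d (A `|` B)%fset + d (A `&` B)%fset <= d A + d B)%N.
  have [q /= [[<- <-] [<- <-]]] := ultra_ex (filterI (filterI (dP A) (dP B))
    (filterI (dP (A `|` B)%fset) (dP (A `&` B)%fset))).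
  rewrite /at_coord imfsetU; apply: leq_trans (dim_submod _ _ _).
  rewrite leq_add2l; apply: dimS; apply/fsubsetP => _ /imfsetP[x /= + ->].
  by rewrite !inE => /andP[xA xB]; apply/andP; split; apply/imfsetP; exists x.
by exists (Pregeometry d0 dstep dsub).
Qed.

Variable K : pregeometry N.
Hypothesis K_dim : forall A, U [set q | G (at_coord A q) = K A].

Definition internal C : set N := [set x | U [set q | C q (ev x q)]].

Lemma internalI C C' : internal (fun q => C q `&` C' q) = internal C `&` internal C'.
Proof.
apply/seteqP; split => [x h|x [h h']]; last exact: filterI h h'.
by split; apply: filterS h => q [].
Qed.

Lemma internal_fcl A : internal (fun q => fcl G (at_coord A q)) = fcl K A.
Proof.
have e q x : at_coord (x |` A)%fset q = (ev x q |` at_coord A q)%fset.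
  by rewrite /at_coord imfsetU1.
apply/seteqP; split => x /= h.
  have [q [/= h1 [h2 h3]]] := ultra_ex (filterI h (filterI (K_dim (x |` A)%fset) (K_dim A))).
  by rewrite /fcl /= -h2 -h3 e.
apply: filterS2 (K_dim (x |` A)%fset) (K_dim A) => q /= h1 h2.
by rewrite /fcl /= -e h1 h2.
Qed.

Lemma internal_fset A C : [set` A] `<=` internal C ->
  U [set q | [set` at_coord A q] `<=` C q].
Proof.
move=> AsC; apply: filterS (filter_forall_seq (s := A) (P := fun x q => C q (ev x q)) AsC).
by move=> q H; apply/at_coord_sub.
Qed.

(** Bases of the C q have almost always the same size, and choosing them
    coordinatewise gives an independent subset of the internal set. *)
Lemma internal_sdim C n :
  (forall q, finite_dim G (C q)) -> (forall q, (sdim G (C q) <= n)%N) ->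
  finite_dim K (internal C) /\ U [set q | sdim G (C q) = sdim K (internal C)].
Proof.
move=> fC Cn; have [v Uv] : exists v, U [set q | sdim G (C q) = v].
  by apply: (@ultra_bounded _ U UU _ n); apply: filterS filterT => q _; apply: Cn.
have [] := @sdim_le _ K (internal C) v.
  move=> A /internal_fset AsC; have [q [/= h1 [h2 h3]]] :=
    ultra_ex (filterI AsC (filterI (K_dim A) Uv)).
  by rewrite -h2 -h3; apply: le_sdim.
move=> fK le; split => //; suff -> : sdim K (internal C) = v by [].
apply/eqP; rewrite eqn_leq le /=.
have basis q : sdim G (C q) = v -> exists t : 'I_v -> M,
    [set` [fset t j | j in 'I_v]%fset] `<=` C q /\ G [fset t j | j in 'I_v]%fset = v.
  move=> qv; have [A [AsC iA GA]] := sdim_max (fC q).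
  have sA : size A == v by rewrite -qv -GA iA.
  exists (tnth (Tuple sA)).
  suff -> : [fset tnth (Tuple sA) j | j in 'I_v]%fset = A by rewrite GA.
  apply/fsetP => x; apply/imfsetP/idP => [[j _ ->]|xA]; first exact: mem_tnth.
  by have /tnthP[j xj] : x \in Tuple sA by []; exists j.
have [q0 /= q0v] := ultra_ex Uv; have [t0 _] := basis _ q0v.
have /choice[t tP] : forall q, exists t : 'I_v -> M, sdim G (C q) = v ->
    [set` [fset t j | j in 'I_v]%fset] `<=` C q /\ G [fset t j | j in 'I_v]%fset = v.
  move=> q; have [qv|nqv] := pselect (sdim G (C q) = v).
    by have [t h] := basis _ qv; exists t.
  by exists t0.
have /choice[x xP] : forall j, exists x, U [set q | ev x q = t q j].
  by move=> j; apply: ev_surj.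
have Ux := filter_forall_fin (UU := UU) xP; pose A := [fset x j | j in 'I_v]%fset.
have Aq : U [set q | at_coord A q = [fset t q j | j in 'I_v]%fset].
  apply: filterS Ux => q /= xq; apply/fsetP => y; apply/imfsetP/imfsetP.
    by move=> [_ /imfsetP[j _ ->] ->]; exists j; rewrite // xq.
  by move=> [j _ ->]; exists (x j); rewrite ?xq//; apply/imfsetP; exists j.
have KA : K A = v.
  have [q [/= h1 [h2 h3]]] := ultra_ex (filterI (K_dim A) (filterI Aq Uv)).
  by rewrite -h1 h2; have [] := tP _ h3.
rewrite -KA; apply: le_sdim => // y /imfsetP[j _ ->].
apply: filterS2 Ux Uv => q /= xq qv; rewrite xq; have [+ _] := tP _ qv; apply.
by apply/imfsetP; exists j.
Qed.

Definition bounded_fdc C :=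
  (forall q, fdc G (C q)) /\ exists n, forall q, (sdim G (C q) <= n)%N.

Lemma bounded_fdcI C C' : bounded_fdc C -> bounded_fdc C' ->
  bounded_fdc (fun q => C q `&` C' q).
Proof.
move=> [fC [n Cn]] [fC' _]; split=> [q|]; first exact: fdcI.
exists n => q; apply: leq_trans (Cn q); apply: sdimS; first exact: subIsetl.
by case: (fC q).
Qed.

Lemma internal_fdc C : bounded_fdc C -> fdc K (internal C).
Proof.
move=> [fC [n Cn]]; split; last first.
  by have [] := internal_sdim (fun q => proj2 (fC q)) Cn.
apply/seteqP; split => [x [A /= AsC xA]|x Cx].
  rewrite -internal_fcl in xA; apply: filterS2 (internal_fset AsC) xA => q /= h1 h2.
  exact: is_closed_fcl (proj1 (fC q)) h1 h2.
exists [fset x]%fset; last by apply: sub_fcl; rewrite /= inE.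
by move=> y /=; rewrite inE => /eqP ->.
Qed.

Lemma fdc_internal E : fdc K E -> exists2 C, bounded_fdc C & internal C = E.
Proof.
move=> /fdc_basis[A _ ->]; exists (fun q => fcl G (at_coord A q)); last exact: internal_fcl.
split=> [q|]; first exact: fdc_fcl.
exists #|` A| => q; rewrite sdim_fcl; apply: leq_trans (dim_le_card _ _) _.
exact: leq_imfset_card.
Qed.

Lemma fdc_internal_seq (s : seq (set N)) : all_fdc K s -> exists2 Cs,
  forall C, C \in Cs -> bounded_fdc C & map internal Cs = s.
Proof.
elim: s => [|E s IH] cs; first by exists [::].
have [|Cs CsP <-] := IH; first by move=> F Fs; apply: cs; rewrite inE Fs orbT.
have [C CP <-] := fdc_internal (cs E (mem_head _ _)); exists (C :: Cs) => // C'.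
by rewrite inE => /orP[/eqP ->|/CsP].
Qed.

Lemma internal_ie (D : I -> set M) (Cs : seq (I -> set M)) :
  (forall C, C \in Cs -> bounded_fdc C) ->
  (forall C, C \in Cs -> bounded_fdc (fun q => D q `&` C q)) ->
  U [set q |
    ie (fun F => (sdim G (D q `&` F))%:Z) (map (@^~ q) Cs) =
    ie (fun F => (sdim K (internal D `&` F))%:Z) (map internal Cs)].
Proof.
elim: Cs D => [|C Cs IH] D bCs bD; first by apply: filterS filterT.
have bCs' C' : C' \in Cs -> bounded_fdc C' by move=> h; apply: bCs; rewrite inE h orbT.
have h0 : U [set q | sdim G (D q `&` C q) = sdim K (internal D `&` internal C)].
  have [fDC [n DCn]] := bD C (mem_head _ _); rewrite -internalI.
  by have [_] := @internal_sdim (fun q => D q `&` C q) n (fun q => proj2 (fDC q)) DCn.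
have h1 := IH D bCs' (fun C' h => bD C' (mem_behead (s := C :: Cs) h)).
have h2 : U [set q | ie (fun F => (sdim G ((D q `&` C q) `&` F))%:Z) (map (@^~ q) Cs) =
    ie (fun F => (sdim K ((internal D `&` internal C) `&` F))%:Z) (map internal Cs)].
  rewrite -internalI; apply: (IH (fun q => D q `&` C q)) => // C' C's.
  by apply: bounded_fdcI; [apply: bD; rewrite mem_head|apply: bCs'].
apply: filterS3 h0 h1 h2 => q /= -> -> e; congr (_ - _).
transitivity (ie (fun F => (sdim G ((D q `&` C q) `&` F))%:Z) (map (@^~ q) Cs)).
  by apply: eq_ie => F; rewrite setIA.
by rewrite e; apply: eq_ie => F; rewrite setIA.
Qed.

(** The alternating sum is a finite expression in dimensions of internal sets, so
    it is computed almost everywhere. *)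
Lemma internal_alt (Cs : seq (I -> set M)) : (forall C, C \in Cs -> bounded_fdc C) ->
  U [set q | alt G (map (@^~ q) Cs) = alt K (map internal Cs)].
Proof.
move=> bCs; have : U [set q |
    ie (fun F => (sdim G (setT `&` F))%:Z) (map (@^~ q) Cs) =
    ie (fun F => (sdim K (internal (fun=> setT) `&` F))%:Z) (map internal Cs)].
  apply: (@internal_ie (fun=> setT)) => // C /bCs bC; rewrite (_ : (fun q => _) = C)//.
  by apply/funext => q; rewrite setTI.
apply: filterS => q /= h; have -> : alt G (map (@^~ q) Cs) =
    ie (fun F => (sdim G (setT `&` F))%:Z) (map (@^~ q) Cs).
  by apply: eq_ie => F; rewrite setTI.
rewrite h; apply: eq_ie => F; rewrite (_ : internal _ = setT) ?setTI//.
by apply/seteqP; split => // x _; apply: filterS filterT.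
Qed.

Lemma ultrapower_flat : flat G -> flat K.
Proof.
move=> /flatP fG; apply/flatP => s cs; have [Cs bCs e] := fdc_internal_seq cs.
have fU : finite_dim K (union_of s) by apply: finite_dim_union => E /cs[].
have [A [AU _ <-]] := sdim_max fU.
have AUq : U [set q | [set` at_coord A q] `<=` union_of (map (@^~ q) Cs)].
  have := @internal_fset A (fun q => union_of (map (@^~ q) Cs)); apply => x /AU.
  rewrite -e => -[_ /mapP[C CCs ->] Cx]; apply: filterS Cx => q Cx.
  by exists (C q) => //; apply: (map_f (@^~ q)).
have [q [/= h1 [h2 h3]]] := ultra_ex (filterI (internal_alt bCs) (filterI AUq (K_dim A))).
have cq : all_fdc G (map (@^~ q) Cs).
  by move=> _ /mapP[C /bCs[fC _] ->]; apply: fC.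
rewrite -e -h1; apply: le_trans (fG _ cq); rewrite lez_nat -h3; apply: le_sdim => //.
by apply: finite_dim_union => E /cq[].
Qed.

Section FiniteParts.
Variables (T : finType) (B : pregeometry T) (c : T -> N).

Definition coords q (t : T) : M := ev (c t) q.

Lemma at_coord_image (A : {fset T}) q :
  at_coord [fset c t | t in A]%fset q = [fset coords q t | t in A]%fset.
Proof. exact: imfset_compose. Qed.

Lemma preimage_internal C : U [set q | coords q @^-1` C q = c @^-1` internal C].
Proof.
have H t : U [set q | C q (coords q t) <-> internal C (c t)].
  have [h|h] := pselect (internal C (c t)).
    by apply: filterS (h) => q Cq; split=> _ //; exact: Cq.
  by apply: filterS (ultra_not h) => q /= nC; split => // /h.
apply: filterS (filter_forall_fin H) => q /= Hq.
by apply/seteqP; split => t /=; move/Hq.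
Qed.

Lemma embedding_coord : embedding B K c <-> U [set q | embedding B G (coords q)].
Proof.
split=> [[c_inj cd]|Uc].
  have inj : U [set q | forall tt : T * T, coords q tt.1 = coords q tt.2 -> tt.1 = tt.2].
    apply: filter_forall_fin => -[t t'] /=.
    have [->|ne] := pselect (t = t'); first by apply: filterS filterT.
    apply: filterS (ultra_not (P := [set q | coords q t = coords q t']) _) => //.
    by move=> /ev_sep /c_inj.
  have dims : U [set q | forall e : {set T}, G [fset coords q t | t in [fset x in e]]%fset =
      B [fset x in e]%fset].
    apply: filter_forall_fin => e; rewrite -cd; apply: filterS (K_dim _) => q Kq.
    rewrite -at_coord_image; exact: Kq.
  apply: filterS2 inj dims => q /= h1 h2; split=> [t t' tt'|A]; first exact: (h1 (t, t')).
  have -> : A = [fset x in [set x in A]%SET]%fset by apply/fsetP => x; rewrite !inE.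
  exact: h2.
split=> [t t' tt'|A].
  by have [q /= [inj _]] := ultra_ex Uc; apply: inj; rewrite /coords tt'.
have [q /= [[_ d] <-]] := ultra_ex (filterI Uc (K_dim [fset c t | t in A]%fset)).
by rewrite at_coord_image d.
Qed.

Lemma preimage_internal_seq (Cs : seq (I -> set M)) :
  U [set q | map (preimage (coords q)) (map (@^~ q) Cs) =
             map (preimage c) (map internal Cs)].
Proof.
elim: Cs => [|C Cs IH]; first by apply: filterS filterT.
by apply: filterS2 IH (preimage_internal C) => q /= -> ->.
Qed.

Lemma strong_of_coord : embedding B K c ->
  U [set q | strong G (range (coords q))] -> strong K (range c).
Proof.
move=> cE Us; apply/strongP => s cs; have [Cs bCs e] := fdc_internal_seq cs.
rewrite -(alt_preimage cE) -e.
have [q [/= [h1 h2] [/strongP h3 h4]]] := ultra_ex (filterI (filterI (internal_alt bCs)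
  (preimage_internal_seq Cs)) (filterI Us (embedding_coord.1 cE))).
rewrite -h1 -h2 (alt_preimage h4); apply: h3.
by move=> _ /mapP[C /bCs[fC _] ->]; apply: fC.
Qed.

End FiniteParts.

(** A family violating strength for c' is internal, and its coordinates violate
    strength for c' almost everywhere. Applying the functions phi coordinatewise
    gives an internal family violating strength for c. The bound on dimensions
    keeps the new family finite-dimensional. *)
Lemma strong_of_coord_transfer (T T' : finType) (B : pregeometry T)
    (B' : pregeometry T') (c : T -> N) (c' : T' -> N) :
  embedding B K c -> strong K (range c) -> embedding B' K c' ->
  U [set q | exists phi : set M -> set M,
    (forall E, fdc G E -> fdc G (phi E) /\ (sdim G (phi E) <= sdim G E)%N) /\
    forall s, all_fdc G s ->
      alt G (map phi s) - alt B (map (preimage (coords c q)) (map phi s)) <=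
      alt G s - alt B' (map (preimage (coords c' q)) s)] ->
  strong K (range c').
Proof.
move=> cE sc cE' Uphi; apply/strongP => s cs.
have [Cs bCs e] := fdc_internal_seq cs; rewrite -(alt_preimage cE') -e.
have /choice[phi phiP] : forall q, exists phi : set M -> set M,
    (forall E, fdc G E -> fdc G (phi E) /\ (sdim G (phi E) <= sdim G E)%N) /\
    ((exists phi : set M -> set M,
    (forall E, fdc G E -> fdc G (phi E) /\ (sdim G (phi E) <= sdim G E)%N) /\
    forall s, all_fdc G s ->
      alt G (map phi s) - alt B (map (preimage (coords c q)) (map phi s)) <=
      alt G s - alt B' (map (preimage (coords c' q)) s)) ->
    forall s, all_fdc G s ->
      alt G (map phi s) - alt B (map (preimage (coords c q)) (map phi s)) <=
      alt G s - alt B' (map (preimage (coords c' q)) s)).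
  move=> q; have [[phi [h1 h2]]|no] := pselect (exists phi : set M -> set M,
    (forall E, fdc G E -> fdc G (phi E) /\ (sdim G (phi E) <= sdim G E)%N) /\
    forall s, all_fdc G s ->
      alt G (map phi s) - alt B (map (preimage (coords c q)) (map phi s)) <=
      alt G s - alt B' (map (preimage (coords c' q)) s)).
    by exists phi.
  by exists id; split => // /no.
pose Ds := [seq (fun q => phi q (C q)) | C <- Cs].
have bDs D : D \in Ds -> bounded_fdc D.
  move=> /mapP[C /bCs[fC [n Cn]] ->]; split=> [q|].
    by have [/(_ _ (fC q))[]] := phiP q.
  exists n => q; apply: leq_trans (Cn q).
  by have [/(_ _ (fC q))[]] := phiP q.
have DsE q : map (@^~ q) Ds = map (phi q) (map (@^~ q) Cs) by rewrite -!map_comp.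
have cDs : all_fdc K (map internal Ds).
  by move=> _ /mapP[D /bDs bD ->]; apply: internal_fdc.
have := (strongP _ _).1 sc _ cDs; rewrite -(alt_preimage cE).
have [q [/= [h1 h2] [[h3 h4] h5]]] := ultra_ex (filterI
  (filterI (internal_alt bCs) (preimage_internal_seq c' Cs))
  (filterI (filterI (internal_alt bDs) (preimage_internal_seq c Ds)) Uphi)).
rewrite -h1 -h2 -h3 -h4 !DsE; have [_ /(_ h5)] := phiP q.
have cq : all_fdc G (map (@^~ q) Cs).
  by move=> _ /mapP[C /bCs[fC _] ->]; apply: fC.
move=> /(_ _ cq) le1 le2; rewrite -subr_ge0.
by apply: (le_trans _ le1); rewrite subr_ge0.
Qed.

End Ultrapower.

(** * Back and forth between the generic pregeometry and its ultrapower *)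

Section BackAndForth.
Variables (I : Type) (U : set_system I).
Context {UU : UltraFilter U}.
Variables (M : countType) (G : pregeometry M).
Hypothesis hG : is_generic G.
Variables (N : choiceType) (ev : N -> I -> M).
Hypothesis ev_sep : forall x y, U [set q | ev x q = ev y q] -> x = y.
Hypothesis ev_surj : forall f, exists x, U [set q | ev x q = f q].
Variable K : pregeometry N.
Hypothesis K_dim : forall A, U [set q | G (at_coord ev A q) = K A].

Record common_strong (T : finType) (B : pregeometry T) (c : T -> M) (cs : T -> N) :
    Prop := CommonStrong {
  common_emb : embedding B G c;
  common_strongM : strong G (range c);
  common_embN : embedding B K cs;
  common_strongN : strong K (range cs) }.

Lemma ultrapower_generic_flat : flat K.
Proof. exact: (ultrapower_flat ev_surj K_dim (generic_flat hG)). Qed.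

(** A finite strong closure in the ultrapower is flat, so the extension property
    of G copies it to G. *)
Lemma extend_in_ultrapower (T : finType) (B : pregeometry T) c cs (X : {fset N}) :
  common_strong B c cs -> exists (T' : finType) (B' : pregeometry T') c' cs' (g : T -> T'),
  [/\ common_strong B' c' cs', c' \o g = c, cs' \o g = cs & [set` X] `<=` range cs'].
Proof.
move=> [cE sc csE scs].
have [Y XY sY] := finite_strong_closure ultrapower_generic_flat
  (X `|` [fset cs t | t in T])%fset.
have [T' [B' [v [vE rv fB']]]] :=
  finite_strong_model ultrapower_generic_flat (finite_fset Y) sY.
have [g gP] : exists g, v \o g = cs.
  apply: factor_through => t; rewrite rv; apply: (fsubsetP XY).
  by rewrite inE; apply/orP; right; apply/imfsetP; exists t.
have gE : embedding B B' g by apply: (embedding_factor vE); rewrite gP.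
have sg : strong B' (range g).
  apply: (strong_preimage vE); first by rewrite rv.
  by rewrite image_comp gP.
have [c' [c'E c'g sc']] := generic_strong_extension hG cE sc fB' gE sg.
exists T', B', c', v, g; split => //; first by split; rewrite // rv.
by rewrite rv => x xX; apply: (fsubsetP XY); rewrite inE [x \in X]xX.
Qed.

(** The coordinates of cs embed T in G almost everywhere but need not be strong,
    so they are extended by [generic_extension_transfer]. *)
Lemma extend_in_generic (T : finType) (B : pregeometry T) c cs (x : M) :
  common_strong B c cs -> exists (T' : finType) (B' : pregeometry T') c' cs' (g : T -> T'),
  [/\ common_strong B' c' cs', c' \o g = c, cs' \o g = cs & range c' x].
Proof.
move=> [cE sc csE scs].
have finX : finite_set (x |` range c).
  by rewrite finite_setU; split; [apply: finite_set1|apply: finite_image].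
have [T' [B' [c' [c'E Xc' sc' fB']]]] := generic_finite_strong hG finX.
have [g gP] : exists g, c' \o g = c.
  by apply: factor_through => t; apply: Xc'; right; exists t.
have gE : embedding B B' g by apply: (embedding_factor c'E); rewrite gP.
have sg : strong B' (range g).
  by apply: (strong_preimage c'E) => //; rewrite image_comp gP.
have /choice[f fP] : forall q, exists f : T' -> M, embedding B G (coords ev cs q) ->
    exists phi : set M -> set M, [/\ embedding B' G f, f \o g = coords ev cs q,
      forall E, fdc G E -> fdc G (phi E) /\ sdim G (phi E) <= sdim G E &
      forall s, all_fdc G s ->
      (alt G (map phi s) - alt B (map (preimage (coords ev cs q)) (map phi s)) <=
      alt G s - alt B' (map (preimage f) s))%R].
  move=> q; have [Eq|nE] := pselect (embedding B G (coords ev cs q)); last by exists c'.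
  have [f [phi H]] := generic_extension_transfer hG Eq fB' gE sg.
  by exists f => _; exists phi.
have /choice[cs' cs'P] : forall t, exists y, U [set q | ev y q = f q t].
  by move=> t; apply: ev_surj.
have Uf : U [set q | coords ev cs' q = f q].
  apply: filterS (filter_forall_fin (UU := UU) cs'P) => q /= H.
  by apply/funext => t; rewrite /coords H.
have UE : U [set q | embedding B G (coords ev cs q)] by apply/embedding_coord; eauto.
have cs'g : cs' \o g = cs.
  apply/funext => t; apply: ev_sep; apply: filterS2 Uf UE => q /= e1 /fP[phi [_ e2 _ _]].
  by rewrite -[LHS]/(coords ev cs' q (g t)) e1 -[LHS]/((f q \o g) t) e2.
have cs'E : embedding B' K cs'.
  apply/(embedding_coord ev_sep K_dim); apply: filterS2 Uf UE => q /= -> /fP[phi []] //.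
have scs' : strong K (range cs').
  apply: (strong_of_coord_transfer ev_surj K_dim csE scs cs'E).
  by apply: filterS2 Uf UE => q /= -> /fP[phi [_ _ h1 h2]]; exists phi.
exists T', B', c', cs', g; split => //.
by apply: Xc'; left.
Qed.

Let L := pregeometry_language.
Let S := pregeometry_structure G.

Section Atomic.
Variables (T : finType) (B : pregeometry T) (C : Type) (k : C -> T).
Variables (n : nat) (w : n.-tuple T).

Definition term_value (t : term C n) : T :=
  match t with Var i => tnth w i | Cst a => k a end.

Lemma eval_value (f : T -> M) t :
  @eval L S C (f \o k) n (map_tuple f w) t = f (term_value t).
Proof. by case: t => //= i; rewrite tnth_map. Qed.

Lemma sat_Rel (f : T -> M) (s : symbol L) (t : (arity s).-tuple (term C n)) :
  embedding B G f ->
  @sat L S C (f \o k) n (Rel t) (map_tuple f w) <->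
  B [fset x in map term_value t]%fset = s.
Proof.
move=> [f_inj fd] /=; rewrite -fd.
rewrite (_ : [fset x in _]%fset = [fset f x | x in [fset x in map term_value t]]%fset)//.
rewrite (_ : map _ t = map f (map term_value t)); last first.
  by rewrite -map_comp; apply: eq_map => u; apply: eval_value.
apply/fsetP => x; apply/imfsetP/imfsetP => -[y /= yt ->].
  have /mapP[z zt ->] := yt; exists z => //; apply/imfsetP; by exists z.
by have /imfsetP[z /= zt ->] := yt; exists (f z) => //; apply: map_f.
Qed.

Lemma sat_Eq (f : T -> M) (t u : term C n) : embedding B G f ->
  @sat L S C (f \o k) n (Eq L t u) (map_tuple f w) <-> term_value t = term_value u.
Proof. by move=> [f_inj _] /=; rewrite !eval_value; split=> [/f_inj|->]. Qed.

End Atomic.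

Lemma ultra_iff (P : I -> Prop) (Q : Prop) : U [set q | P q <-> Q] -> Q <-> U P.
Proof.
move=> PQ; split=> [q|UP]; first by apply: filterS PQ => x [_]; apply.
by have [x [/= [+ _]]] := ultra_ex (filterI PQ UP); apply.
Qed.

(** Only the quantifier case uses that the copies are strong: a counterexample in
    almost all coordinates is an element of the ultrapower and is moved to G by
    [extend_in_ultrapower], and an element of G is moved to the ultrapower by
    [extend_in_generic]. *)
Lemma sat_transfer (C : Type) (n : nat) (phi : formula L C n) (T : finType)
    (B : pregeometry T) c cs (k : C -> T) (w : n.-tuple T) : common_strong B c cs ->
  @sat L S C (c \o k) n phi (map_tuple c w) <->
  U [set q | @sat L S C (coords ev cs q \o k) n phi (map_tuple (coords ev cs q) w)].
Proof.
have UE (T0 : finType) (B0 : pregeometry T0) c0 cs0 : common_strong B0 c0 cs0 ->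
    U [set q | embedding B0 G (coords ev cs0 q)].
  by move=> [_ _ csE _]; apply/(embedding_coord ev_sep K_dim).
elim: phi T B c cs k w => {n} [n s t|n t u|n|n phi IH1 psi IH2|n phi IH] T B c cs k w H.
- rewrite (sat_Rel (B := B)); last by case: H.
  by apply: ultra_iff; apply: filterS (UE _ _ _ _ H) => q; apply: sat_Rel.
- rewrite (sat_Eq (B := B)); last by case: H.
  by apply: ultra_iff; apply: filterS (UE _ _ _ _ H) => q; apply: sat_Eq.
- by split=> //= /ultra_ex[].
- split=> /= [h|h /(IH1 _ _ _ _ _ _ H) h1]; last first.
    by apply/(IH2 _ _ _ _ _ _ H); apply: filterS2 h h1 => q; apply.
  have [/h/(IH2 _ _ _ _ _ _ H) h1|n1] := pselect (@sat L S C (c \o k) n phi (map_tuple c w)).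
    by apply: filterS h1 => q ? ?.
  have /ultra_not : ~ U [set q | @sat L S C (coords ev cs q \o k) n phi
    (map_tuple (coords ev cs q) w)] by move=> /(IH1 _ _ _ _ _ _ H).
  by apply: filterS => q /= ? ?.
- have step (T' : finType) (g : T -> T') t (X : Type) (f : T' -> X) :
      [tuple of f t :: map_tuple (f \o g) w] = map_tuple f [tuple of t :: map_tuple g w].
    by apply: val_inj => /=; rewrite -map_comp.
  split=> /= [h|h x].
    apply: contrapT => /ultra_not Un.
    have [q0 /= /existsNP[x0 _]] := ultra_ex Un.
    have /choice[x xP] : forall q, exists x,
        (~ forall x, @sat L S C (coords ev cs q \o k) n.+1 phi
          [tuple of x :: map_tuple (coords ev cs q) w]) ->
        ~ @sat L S C (coords ev cs q \o k) n.+1 phi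
          [tuple of x :: map_tuple (coords ev cs q) w].
      move=> q; have [hq|/existsNP[x nx]] := pselect (forall x, @sat L S C
        (coords ev cs q \o k) n.+1 phi [tuple of x :: map_tuple (coords ev cs q) w]).
        by exists x0 => /(_ hq).
      by exists x.
    have [y Uy] := ev_surj x.
    have [T' [B' [c' [cs' [g [H' c'g cs'g Xcs']]]]]] := extend_in_ultrapower [fset y]%fset H.
    have [t _ ty] : range cs' y by apply: Xcs'; rewrite /= inE.
    have := h (c' t); rewrite -c'g step => /(IH _ _ _ _ (g \o k) _ H') h1.
    have [q [/= h2 [h3 h4]]] := ultra_ex (filterI h1 (filterI Un Uy)).
    apply: (xP _ h3); rewrite -h4 -ty -cs'g.
    by move: h2; rewrite -step.
  have [T' [B' [c' [cs' [g [H' c'g cs'g [t _ tx]]]]]]] := extend_in_generic x H.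
  rewrite -tx -c'g step; apply/(IH _ _ _ _ (g \o k) _ H').
  by apply: filterS h => q /= /(_ (coords ev cs' q t)); rewrite -cs'g -step.
Qed.

End BackAndForth.

(** * Saturation *)

Section CompactnessUltrafilter.
Variables (X : Type) (p : set X).

Lemma exists_compactness_ultrafilter : exists U : set_system (set X),
  UltraFilter U /\ forall x, p x ->
    U [set q | [/\ finite_set q, q `<=` p & q x]].
Proof.
pose F : set_system (set X) := [set S | exists q0, [/\ finite_set q0, q0 `<=` p &
  forall q, finite_set q -> q `<=` p -> q0 `<=` q -> S q]].
have FF : ProperFilter F.
  split; first by move=> [q0 [f0 p0]] /(_ q0 f0 p0); apply.
  split.
  - by exists set0; split => //; apply: finite_set0.
  - move=> S S' [q [fq pq Sq]] [q' [fq' pq' Sq']]; exists (q `|` q'); split.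
    + by rewrite finite_setU.
    + by move=> x [/pq|/pq'].
    + by move=> r fr pr qr; split; [apply: Sq|apply: Sq'] => // x qx; apply: qr; [left|right].
  - by move=> S S' SS' [q [fq pq Sq]]; exists q; split => // r fr pr qr; apply: SS'; apply: Sq.
have [U [UU FU]] := ultraFilterLemma FF; exists U; split => // x px; apply: FU.
exists [set x]; split; [exact: finite_set1|by move=> y ->|].
by move=> q fq pq xq; split => //; apply: xq.
Qed.

End CompactnessUltrafilter.

Theorem theorem3p2p16 (M : countType) (G : pregeometry M) (hG : is_generic G) :
  saturated (pregeometry_structure G).
Proof.
move=> A cardA n p [p_fin _].
have finA : finite_set A.
  apply/finite_setPn => natA; apply: cardA; apply: card_le_trans natA.
  exact: countableP.
have [U [UU Up]] := exists_compactness_ultrafilter p.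
have [e0 _] := p_fin set0 (finite_set0 _) (@sub0set _ _).
have /choice[e eP] : forall q, exists e : n.-tuple (pregeometry_structure G),
    finite_set q -> q `<=` p -> realizes e q.
  move=> q; have [fq|nf] := pselect (finite_set q); last by exists e0.
  have [pq|np] := pselect (q `<=` p); last by exists e0.
  by have [e eq] := p_fin q fq pq; exists e.
have [N [ev [ev_sep ev_surj]]] := exists_ultrapower (U := U) M.
have [K K_dim] := ultrapower_pregeometry (U := U) G ev.
have [T0 [B0 [v0 [v0E Av0 sv0 _]]]] := generic_finite_strong hG finA.
have [k0 k0P] := @factor_through _ _ _ v0 (set_val : A -> M) (fun a => Av0 _ (set_valP a)).
have /choice[cs0 cs0P] : forall t, exists x, U [set q | ev x q = v0 t].
  by move=> t; apply: (ev_surj (fun=> v0 t)).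
have U0 : U [set q | coords ev cs0 q = v0].
  apply: filterS (filter_forall_fin (UU := UU) cs0P) => q /= H.
  by apply/funext => t; apply: H.
have cs0E : embedding B0 K cs0.
  by apply/(embedding_coord ev_sep K_dim); apply: filterS U0 => q /= ->.
have H0 : common_strong G K B0 v0 cs0.
  split => //; apply: (strong_of_coord ev_sep ev_surj K_dim cs0E).
  by apply: filterS U0 => q /= ->.
have /choice[y yP] : forall i : 'I_n, exists x, U [set q | ev x q = tnth (e q) i].
  by move=> i; apply: ev_surj.
have [T [B [c [cs [g [H cg csg ycs]]]]]] :=
  extend_in_ultrapower hG ev_surj K_dim [fset y i | i in 'I_n]%fset H0.
have [w wP] : exists w : 'I_n -> T, forall i, cs (w i) = y i.
  have /choice[w wP] : forall i, exists t, cs t = y i.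
    by move=> i; have [|t _ <-] := ycs (y i); [apply/imfsetP; exists i|exists t].
  by exists w.
pose tw := [tuple w i | i < n]; exists (map_tuple c tw) => phi pphi.
have cA : c \o (g \o k0) = set_val by rewrite -k0P -cg.
rewrite -cA; apply/(sat_transfer hG ev_sep ev_surj K_dim phi (g \o k0) tw H).
have Uy := filter_forall_fin (UU := UU) yP.
apply: filterS3 (Up _ pphi) U0 Uy => q /= [fq pq qphi] q0 qy.
have -> : coords ev cs q \o (g \o k0) = set_val.
  by rewrite -k0P -q0 -csg.
have -> : map_tuple (coords ev cs q) tw = e q; last exact: eP.
by apply: eq_from_tnth => i; rewrite tnth_map tnth_mktuple /coords wP.
Qed.
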